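(* Consider the sparse linear Gaussian model: $S\in\{1,\dots,N\}$, $\mathcal{X}_S=\{\mathbf{x}\in\mathbb{R}^N:\|\mathbf{x}\|_0\le S\}$, $\mathbf{H}\in\mathbb{R}^{M\times N}$ with $\operatorname{spark}(\mathbf{H})>S$, $\sigma>0$, observation $\mathbf{y}=\mathbf{H}\mathbf{x}+\mathbf{n}$, $\mathbf{n}\sim\mathcal{N}(\mathbf{0},\sigma^2\mathbf{I})$, a parameter function $g:\mathcal{X}_S\to\mathbb{R}$, and $\mathbf{x}_0\in\mathcal{X}_S$. Let $D=\operatorname{rank}(\mathbf{H})$, $\mathbf{H}=\mathbf{U}\mathbf{\Sigma}\mathbf{V}^T$ a thin SVD and $\widetilde{\mathbf{H}}=\mathbf{V}\mathbf{\Sigma}^{-1}$. Let $c:\mathcal{X}_S\to\mathbb{R}$ be a bias function valid at $\mathbf{x}_0$, $\gamma=c+g$, and let $\mathcal{C}(c)\subseteq\ell^2(\mathbb{Z}_+^D)$ be the set of sequences $a$ such that for all $\mathbf{x}\in\mathcal{X}_S$ $$c(\mathbf{x})=\exp\Big(\tfrac{1}{2\sigma^2}\|\mathbf{H}\mathbf{x}_0\|_2^2-\tfrac{1}{\sigma^2}\mathbf{x}^T\mathbf{H}^T\mathbf{H}\mathbf{x}_0\Big)\sum_{\mathbf{p}\in\mathbb{Z}_+^D}\frac{a[\mathbf{p}]}{\sqrt{\mathbf{p}!}}\Big(\tfrac{1}{\sigma}\widetilde{\mathbf{H}}^{\dagger}\mathbf{x}\Big)^{\mathbf{p}}-g(\mathbf{x}).$$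 Define $\rho_{\mathbf{x}_0}(\mathbf{y},\mathbf{x})=\exp\big(-\tfrac{1}{2\sigma^2}[2\mathbf{y}^T\mathbf{H}(\mathbf{x}_0-\mathbf{x})+\|\mathbf{H}\mathbf{x}\|_2^2-\|\mathbf{H}\mathbf{x}_0\|_2^2]\big)$ for $\mathbf{x}\in\mathbb{R}^N$ and $$\chi_{\mathbf{p}}(\mathbf{y})=\frac{\partial^{\mathbf{p}}}{\partial\mathbf{z}^{\mathbf{p}}}\Big[\rho_{\mathbf{x}_0}(\mathbf{y},\sigma\widetilde{\mathbf{H}}\mathbf{z})\exp\big(\tfrac{1}{\sigma}\mathbf{x}_0^T\mathbf{H}^T\mathbf{H}\widetilde{\mathbf{H}}\mathbf{z}\big)\Big]\Big|_{\mathbf{z}=\mathbf{0}},\quad\mathbf{p}\in\mathbb{Z}_+^D.$$ Then: (1) The minimum achievable variance at $\mathbf{x}_0$ equals $M(c,\mathbf{x}_0)=\min_{a\in\mathcal{C}(c)}\sum_{\mathbf{p}\in\mathbb{Z}_+^D}a^2[\mathbf{p}]-\gamma^2(\mathbf{x}_0)$ (the minimum being attained). (2) For every $a\in\mathcal{C}(c)$, the estimator $\hat g(\mathbf{y})=\exp\big(-\tfrac{1}{2\sigma^2}\|\mathbf{H}\mathbf{x}_0\|_2^2\big)\sum_{\mathbf{p}\in\mathbb{Z}_+^D}\frac{a[\mathbf{p}]}{\sqrt{\mathbf{p}!}}\chi_{\mathbf{p}}(\mathbf{y})$ has finite variance at $\mathbf{x}_0$ and bias function equal to $c$ on $\mathcal{X}_S$.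 (3) The LMV estimator at $\mathbf{x}_0$ for $c$ is the estimator in (2) with $a=a_0=\arg\min_{a\in\mathcal{C}(c)}\|a\|_{\ell^2(\mathbb{Z}_+^D)}$.
   Context: $\|\cdot\|_0$ = number of nonzero entries; $\operatorname{spark}$ = minimum number of linearly dependent columns; $\dagger$ = Moore–Penrose pseudoinverse; multi-index notation $\mathbf{p}!=\prod p_l!$, $\mathbf{z}^{\mathbf{p}}=\prod z_l^{p_l}$, $\partial^{\mathbf{p}}/\partial\mathbf{z}^{\mathbf{p}}=\prod_l\partial^{p_l}/\partial z_l^{p_l}$. An estimator $\hat g:\mathbb{R}^M\to\mathbb{R}$ has bias $b(\hat g;\mathbf{x})=\mathsf{E}_{\mathbf{x}}\{\hat g(\mathbf{y})\}-g(\mathbf{x})$ and variance $v(\hat g;\mathbf{x})=\mathsf{E}_{\mathbf{x}}\{(\hat g(\mathbf{y})-\mathsf{E}_{\mathbf{x}}\hat g(\mathbf{y}))^2\}$. $c$ is valid at $\mathbf{x}_0$ if the set $\mathcal{A}(c,\mathbf{x}_0)$ of estimators with $v(\hat g;\mathbf{x}_0)<\infty$ and $b(\hat g;\mathbf{x})=c(\mathbf{x})$ for all $\mathbf{x}\in\mathcal{X}_S$ is nonempty; the minimum achievable variance is $M(c,\mathbf{x}_0)=\inf_{\hat g\in\mathcal{A}(c,\mathbf{x}_0)}v(\hat g;\mathbf{x}_0)$, and an LMV (locally minimum variance) estimator is an element of $\mathcal{A}(c,\mathbf{x}_0)$ attaining this infimum. *)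

(* Defs.v *)
From HB Require Import structures.
From mathcomp Require Import all_boot all_order all_algebra.
From mathcomp Require Import all_classical all_reals all_analysis.
Set Implicit Arguments. Unset Strict Implicit. Unset Printing Implicit Defensive.
Import Order.TTheory GRing.Theory Num.Theory.
Import numFieldNormedType.Exports.
Local Open Scope classical_set_scope.
Local Open Scope ring_scope.

Section LinAlg.
Variable R : realType.

Definition l0norm n (x : 'cV[R]_n) : nat := #|[set i | x i 0 != 0]|.

Definition sparse_set {N : nat} (S : nat) : set 'cV[R]_N :=
  [set x | (l0norm x <= S)%N].

Definition lin_dep_cols M N (H : 'M[R]_(M, N)) (T : {set 'I_N}) : Prop :=
  exists v : 'cV[R]_N, v != 0 /\ (forall i, i \notin T -> v i 0 = 0) /\
                       H *m v = 0.

(* spark H = minimum number of linearly dependent columns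
   (= N+1, standing for +infinity, if the columns are independent) *)
Definition spark M N (H : 'M[R]_(M, N)) : nat :=
  \big[minn/N.+1]_(T : {set 'I_N} | `[< lin_dep_cols H T >]) #|T|.

Definition is_pinv m n (A : 'M[R]_(m, n)) (B : 'M[R]_(n, m)) : Prop :=
  [/\ A *m B *m A = A, B *m A *m B = B,
      (A *m B)^T = A *m B & (B *m A)^T = B *m A].

Definition thin_svd M N D (H : 'M[R]_(M, N)) (U : 'M[R]_(M, D))
  (s : 'rV[R]_D) (V : 'M[R]_(N, D)) : Prop :=
  [/\ U^T *m U = 1%:M, V^T *m V = 1%:M, (forall i, 0 < s 0 i) &
      H = U *m diag_mx s *m V^T].

Definition sqnorm n (x : 'cV[R]_n) : R := \sum_i (x i 0) ^+ 2.

Definition tcol n (t : n.-tuple R) : 'cV[R]_n := \col_i tnth t i.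

End LinAlg.

Notation mindex D := {ffun 'I_D -> nat}.

Section MultiIndex.
Variable R : realType.


Definition mfact D (p : mindex D) : R := \prod_l ((p l)`!)%:R.
Definition mpow D (z : 'cV[R]_D) (p : mindex D) : R := \prod_l (z l 0) ^+ (p l).

Definition in_l2 D (a : mindex D -> R) : Prop :=
  (\esum_(p in [set: mindex D]) ((a p) ^+ 2)%:E < +oo)%E.

Definition l2sq D (a : mindex D -> R) : R :=
  fine (\esum_(p in [set: mindex D]) ((a p) ^+ 2)%:E).

(* unordered sum of a (absolutely summable) real family over a countable
   index set: positive part minus negative part *)
Definition usum (T : choiceType) (f : T -> R) : R :=
  fine (\esum_(i in [set: T]) (Num.max (f i) 0)%:E) -
  fine (\esum_(i in [set: T]) (Num.max (- f i) 0)%:E).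

Definition partial D (l : 'I_D) (f : 'cV[R]_D -> R) : 'cV[R]_D -> R :=
  'D_(delta_mx l 0 : 'cV[R]_D) f.

Definition mderiv D (p : mindex D) (f : 'cV[R]_D -> R) : 'cV[R]_D -> R :=
  foldr (fun l h => iter (p l) (partial l) h) f (enum 'I_D).

End MultiIndex.

Section Model.
Local Open Scope ereal_scope.
Context {R : realType} {d : measure_display} {Omega : measurableType d}.
Variable P : probability Omega R.
Variables (M N : nat) (H : 'M[R]_(M, N)) (noise : Omega -> M.-tuple R).

(* noise has i.i.d. N(0, sigma^2) components: its law on the product
   sigma-algebra of R^M is the product of the normal laws *)
Definition gauss_noise (sigma : R) : Prop :=
  measurable_fun [set: Omega] noise /\
  forall B : 'I_M -> set R, (forall i, measurable (B i)) ->
    P [set w | forall i, B i (tnth (noise w) i)] =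
    ((\prod_i fine (normal_prob 0 sigma (B i)))%R)%:E.

Definition obs (x : 'cV[R]_N) (w : Omega) : 'cV[R]_M :=
  (H *m x + tcol (noise w))%R.

Definition is_estimator (gh : 'cV[R]_M -> R) : Prop :=
  measurable_fun [set: M.-tuple R] (gh \o @tcol R M).

Definition mean (gh : 'cV[R]_M -> R) (x : 'cV[R]_N) : R :=
  fine (\int[P]_w (gh (obs x w))%:E).

Definition est_variance (gh : 'cV[R]_M -> R) (x : 'cV[R]_N) : \bar R :=
  \int[P]_w (((gh (obs x w) - mean gh x) ^+ 2)%R)%:E.

Definition bias (gh : 'cV[R]_M -> R) (g : 'cV[R]_N -> R) (x : 'cV[R]_N) : R :=
  (mean gh x - g x)%R.

Definition mean_exists (gh : 'cV[R]_M -> R) (x : 'cV[R]_N) : Prop :=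
  P.-integrable [set: Omega] (fun w => (gh (obs x w))%:E).

Definition admissible (S : nat) (g c : 'cV[R]_N -> R) (x0 : 'cV[R]_N)
  : set ('cV[R]_M -> R) :=
  [set gh | [/\ is_estimator gh, mean_exists gh x0, est_variance gh x0 < +oo &
     forall x, sparse_set S x -> mean_exists gh x /\ bias gh g x = c x]].

Definition valid_bias S g c x0 : Prop := admissible S g c x0 !=set0.

Definition min_var S g c x0 : R :=
  inf [set fine (est_variance gh x0) | gh in admissible S g c x0].

Definition is_LMV S g c x0 (gh : 'cV[R]_M -> R) : Prop :=
  admissible S g c x0 gh /\ fine (est_variance gh x0) = min_var S g c x0.

(* gh is an L^2(P_{x0}) limit of the partial sums (over the boxes
   {p : p_l <= K}) of the series sum_p t p *)
Definition L2_series_limit D (t : mindex D -> 'cV[R]_M -> R) (x0 : 'cV[R]_N)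
  (gh : 'cV[R]_M -> R) : Prop :=
  is_estimator gh /\
  (fun K : nat => \int[P]_w
     (((\sum_(q : {ffun 'I_D -> 'I_K.+1}) t [ffun l => val (q l)] (obs x0 w)
        - gh (obs x0 w)) ^+ 2)%R)%:E) @ \oo --> 0.

End Model.

(* Main.v *)
Require Import Defs.
From HB Require Import structures.
From mathcomp Require Import all_boot all_order all_algebra.
From mathcomp Require Import all_classical all_reals all_analysis.
From mathcomp Require Import measurable_realfun ring lra.
Set Implicit Arguments. Unset Strict Implicit. Unset Printing Implicit Defensive.
Import Order.TTheory GRing.Theory Num.Theory.
Import numFieldNormedType.Exports.
Local Open Scope classical_set_scope.
Local Open Scope ring_scope.

(** Write m0 = H x0, n for the noise, and z = U^T H x / sigma = Ht^+ x / sigma.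
    The functions e_p = exp (- |m0|^2 / (2 sigma^2)) chi_p / sqrt p! form an
    orthonormal family in L^2 of the law at x0: chi_p is an exponential times a
    product of Hermite polynomials in U^T (y + m0) / sigma, and translating the
    noise by -2 m0 (Cameron-Martin) turns the exponential factor into the
    density, leaving Hermite polynomials of a standard Gaussian vector.  The
    same computation gives the coefficients of the likelihood ratio L_x of
    the model at x with respect to the model at x0:
      E [L_x e_p] = exp (|m0|^2 / (2 sigma^2) - x^T H^T H x0 / sigma^2) z^p / sqrt p!.
    The squares of these coefficients add up to E [L_x^2], so L_x is in the
    closed span of the e_p, whence E_x gh = sum_p <gh, e_p> <L_x, e_p> for every
    square integrable gh.  Thus the coefficient sequences of admissible
    estimators lie in C(c); Bessel's inequality bounds the variance from below
    by the l2 norm, and Riesz-Fischer produces an estimator from any sequence in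
    C(c).  The minimum over C(c) exists because C(c) is convex and closed. *)

(** Of the noise only measurability and the law on boxes are given. Expectations of products are
    therefore reached by trading indicators for functions one coordinate at a time, and Gaussian
    moments by differentiating a moment generating function, which is itself the normalisation of a
    Cameron-Martin density. The shift by -2 m0 is forced: with y = m0 + n, the factors exp (- y . m0
    / sigma^2) of two basis functions multiply to exp (-2 m0 . n / sigma^2 - 2 |m0|^2 / sigma^2),
    exactly the density of that translation, and it carries the Hermite argument y + m0 = n + 2 m0
    back to n. The e_p need not span L^2, since an estimator may depend on the part of y orthogonal
    to the range of H; this is why estimators are only ever paired with L_x, for which Bessel's
    inequality is an equality. Series are summed over boxes because there the sum of the squared
    coefficients of L_x factorises into exponential series. *)

(** * Transfer of integrals under weighted images *)

Section integral_transfer.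
Local Open Scope ereal_scope.
Context d1 d2 (X : measurableType d1) (Y : measurableType d2) (R : realType).
Variables (mu : {measure set X -> \bar R}) (nu : {measure set Y -> \bar R}).
Variables (phi : X -> Y) (w : X -> R).
Hypotheses (mphi : measurable_fun setT phi) (mw : measurable_fun setT w).
Hypothesis w0 : forall x, (0 <= w x)%R.
Hypothesis nuE : forall B, measurable B ->
  \int[mu]_x ((w x * \1_B (phi x))%R)%:E = nu B.

Import HBNNSimple.

(** An identity on measurable sets passes to nonnegative functions through simple approximations and
    monotone convergence. Weight and map are kept general to cover densities, translations, single
    noise coordinates and the Cameron-Martin formula. *)
Lemma ge0_integral_transfer (f : Y -> R) :
  measurable_fun setT f -> (forall y, (0 <= f y)%R) ->
  \int[mu]_x ((w x * f (phi x))%R)%:E = \int[nu]_y (f y)%:E.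
Proof.
move=> mf f0.
have mEf : measurable_fun [set: Y] (fun y => (f y)%:E) by exact/measurable_EFinP.
pose f_ := nnsfun_approx measurableT mEf.
have cf y : (f_ n y)%:E @[n --> \oo] --> (f y)%:E.
  by apply: cvg_nnsfun_approx => // z _; rewrite lee_fin.
have ndf y m n : (m <= n)%N -> (f_ m y <= f_ n y)%R.
  by move=> mn; exact/lefP/nd_nnsfun_approx.
have mwf (g : Y -> R) : measurable_fun setT g ->
    measurable_fun setT (fun x => ((w x * g (phi x))%R)%:E).
  move=> mg; apply/measurable_EFinP; apply: measurable_funM => //.
  exact: measurableT_comp.
transitivity (limn (fun n => \int[nu]_y (f_ n y)%:E)); last first.
  rewrite -monotone_convergence//.
  - by apply: eq_integral => y _; apply/cvg_lim.
  - by move=> n; exact/measurable_EFinP/measurable_funP.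
  - by move=> n y _; rewrite lee_fin.
  - by move=> y _ m n mn; rewrite lee_fin; exact: ndf.
transitivity (limn (fun n => \int[mu]_x ((w x * f_ n (phi x))%R)%:E)).
  rewrite -monotone_convergence//.
  - apply: eq_integral => x _; apply/esym/cvg_lim => //.
    under eq_fun do rewrite EFinM.
    by rewrite EFinM; apply: cvgeZl => //; exact: cf.
  - by move=> n; apply: mwf.
  - by move=> n x _; rewrite lee_fin mulr_ge0.
  - by move=> x _ m n mn; rewrite lee_fin ler_wpM2l//; exact: ndf.
congr (limn _); apply/funext => n.
have mI r : measurable (f_ n @^-1` [set r]).
  by rewrite -(setTI (_ @^-1` _)); exact: (measurable_funP (f_ n)).
have mwI r : measurable_fun setT
    (fun x => (w x * \1_(f_ n @^-1` [set r]) (phi x))%R).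
  by apply/measurable_EFinP; apply: mwf.
transitivity (\sum_(k \in range (f_ n))
    \int[mu]_x (k * (w x * \1_(f_ n @^-1` [set k]) (phi x)))%R%:E); last first.
  under [in RHS]eq_integral do rewrite fimfunE -fsumEFin//.
  rewrite ge0_integral_fsum//; last 2 first.
  - by move=> y; exact/measurable_EFinP/measurable_funM.
  - by move=> y x _; rewrite nnfun_muleindic_ge0.
  apply: eq_fsbigr => r _; rewrite integralZl_indic_nnsfun// integral_indic//= setIT.
  (* A nonnegative simple function has an empty preimage at a negative [r], and then both sides
     vanish. *)
  have [r0|r0] := leP 0%R r.
    under eq_integral do rewrite EFinM.
    rewrite ge0_integralZl//= ?nuE//; first exact/measurable_EFinP.
    by move=> x _; rewrite lee_fin mulr_ge0.
  rewrite preimage_nnfun0// measure0 mule0.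
  by rewrite integral0_eq// => x _; rewrite indic0 !mulr0.
rewrite -ge0_integral_fsum//.
- apply: eq_integral => x _; rewrite fsumEFin// fimfunE; congr EFin.
  rewrite !fsbig_finite//= mulr_sumr; apply: eq_bigr => r _.
  by rewrite mulrCA.
- by move=> r; apply/measurable_EFinP; exact: measurable_funM.
- move=> r x _; rewrite lee_fin.
  have := nnfun_muleindic_ge0 (f_ n) r (phi x); rewrite lee_fin => ?.
  by rewrite mulrCA mulr_ge0.
Qed.

End integral_transfer.

(** * Translation of the one-dimensional normal law *)

Section normal_shift.
Local Open Scope ereal_scope.
Context {R : realType}.
Notation mu := (@lebesgue_measure R).

Lemma lebesgue_measure_shift (h : R) (A : set R) : measurable A ->
  mu ((fun x => (x + h)%R) @^-1` A) = mu A.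
Proof.
have mh : measurable_fun [set: R] (fun x => (x + h)%R : measurableTypeR R).
  exact: measurable_funD.
move=> mA; change (pushforward mu (fun x => (x + h)%R : measurableTypeR R) A = mu A).
apply/esym/lebesgue_measure_unique => //= _ [[a b]] _ <-.
rewrite /pushforward.
rewrite (_ : _ @^-1` _ = `](a - h)%R, (b - h)%R]%classic).
  rewrite !lebesgue_measure_itv/= !lte_fin ltrD2r.
  by case: ifP => // _; rewrite -!EFinB; congr EFin; lra.
by apply/seteqP; split=> x /=; rewrite !in_itv/= ltrBlDr lerBrDr.
Qed.

Lemma ge0_integral_normal_prob (m s : R) (f : R -> R) :
  measurable_fun setT f -> (forall x, (0 <= f x)%R) ->
  \int[normal_prob m s]_x (f x)%:E =
  \int[mu]_x ((normal_pdf m s x * f x)%R)%:E.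
Proof.
move=> mf f0; apply/esym.
apply: (@ge0_integral_transfer _ _ _ _ R mu (normal_prob m s) id) => //.
- exact: measurable_normal_pdf.
- by move=> x; exact: normal_pdf_ge0.
- move=> B mB; rewrite /normal_prob [RHS]integral_mkcond/=.
  apply: eq_integral => x _; rewrite patchE indicE.
  by case: ifP => xB; rewrite ?mulr1 ?mulr0.
Qed.

(** Completing the square turns the exponential times the centred density into the density centred
    at [h]; translation invariance of Lebesgue measure then moves the shift to the set. *)
Lemma normal_prob_shift (s h : R) (B : set R) : (0 < s)%R -> measurable B ->
  \int[normal_prob 0 s]_x
    ((expR (h * x / s ^+ 2 - h ^+ 2 / (2 * s ^+ 2)) * \1_B x)%R)%:E =
  normal_prob 0 s ((fun x => (x + h)%R) @^-1` B).
Proof.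
move=> s0 mB.
have mh : measurable_fun [set: R] (fun x => (x + h)%R) by exact: measurable_funD.
have mB' : measurable ((fun x => (x + h)%R) @^-1` B).
  by rewrite -(setTI (_ @^-1` _)); exact: mh.
have sN0 : s != 0%R by rewrite gt_eqF.
rewrite ge0_integral_normal_prob; last 2 first.
- apply: measurable_funM => //; apply: measurableT_comp => //.
  apply: measurable_funB => //.
  by apply: measurable_funM => //; apply: measurable_funM.
- by move=> x; rewrite mulr_ge0 ?expR_ge0.
transitivity (\int[mu]_x ((normal_pdf 0 s (x - h) * \1_B x)%R)%:E).
  apply: eq_integral => x _; congr EFin; rewrite mulrA; congr (_ * _)%R.
  rewrite !normal_pdfE//= -[LHS]mulrA; congr (_ * _)%R.
  rewrite /normal_fun -expRD; congr expR; rewrite subr0 -mulr_natl.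
  by field; rewrite sN0.
transitivity (\int[mu]_x ((1 * (normal_pdf 0 s ((x + h) - h) * \1_B (x + h)))%R)%:E).
  apply/esym.
  apply: (@ge0_integral_transfer _ _ _ _ R mu mu (fun x => (x + h)%R) (fun=> 1%R)
     mh _ _ _ (fun x => (normal_pdf 0 s (x - h) * \1_B x)%R)) => //.
  - move=> A mA; under eq_integral do rewrite mul1r.
    transitivity (mu ((fun x => (x + h)%R) @^-1` A)); last exact: lebesgue_measure_shift.
    rewrite -[in RHS](setIT (_ @^-1` _)) -integral_indic//.
    by rewrite -(setTI (_ @^-1` _)); exact: mh.
  - apply: measurable_funM => //.
    apply: measurableT_comp; first exact: measurable_normal_pdf.
    exact: measurable_funB.
  - by move=> x; rewrite mulr_ge0 ?normal_pdf_ge0.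
rewrite /normal_prob [RHS]integral_mkcond; apply: eq_integral => x _.
rewrite mul1r addrK patchE indicE.
have -> : (x \in (fun x => (x + h)%R) @^-1` B) = ((x + h)%R \in B).
  by apply/idP/idP; rewrite !inE.
by case: ifP => _; rewrite ?mulr1 ?mulr0.
Qed.

End normal_shift.

(** * Weighted image measures and uniqueness on boxes *)

Section weighted_pushforward.
Local Open Scope ereal_scope.
Context d1 d2 (X : measurableType d1) (Y : measurableType d2) (R : realType).
Variables (mu : {measure set X -> \bar R}) (phi : X -> Y) (w : X -> R).
Hypotheses (mphi : measurable_fun setT phi) (mw : measurable_fun setT w).
Hypothesis w0 : forall x, (0 <= w x)%R.

(** The image under [phi] of [mu] with density [w]. It receives a measure structure so that it can
    be compared with an ordinary image measure by uniqueness on boxes. *)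
Definition wpush (B : set Y) : \bar R := \int[mu]_(x in phi @^-1` B) (w x)%:E.

Let wpush0 : wpush set0 = 0.
Proof. by rewrite /wpush preimage_set0 integral_set0. Qed.

Let wpush_ge0 B : 0 <= wpush B.
Proof. by apply: integral_ge0 => x _; rewrite lee_fin. Qed.

Let wpush_sigma_additive : semi_sigma_additive wpush.
Proof.
move=> F mF tF mUF; rewrite /wpush preimage_bigcup ge0_integral_bigcup.
- apply: is_cvg_ereal_nneg_natsum_cond => n _ _.
  by apply: integral_ge0 => x _; rewrite lee_fin.
- by move=> n; rewrite -[X in measurable X]setTI; exact: mphi.
- by apply: measurable_funTS; exact/measurable_EFinP.
- by move=> x _; rewrite lee_fin.
- apply/trivIsetP => /= i j _ _ ij; rewrite -preimage_setI.
  by move/trivIsetP : tF => /(_ _ _ _ _ ij) ->//; rewrite preimage_set0.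
Qed.

HB.instance Definition _ := isMeasure.Build _ _ _ wpush
  wpush0 wpush_ge0 wpush_sigma_additive.

Lemma wpushE B : wpush B = \int[mu]_x ((w x * \1_B (phi x))%R)%:E.
Proof.
rewrite /wpush integral_mkcond; apply: eq_integral => x _.
rewrite patchE indicE.
have -> : (x \in phi @^-1` B) = (phi x \in B) by apply/idP/idP; rewrite !inE.
by case: ifP => _; rewrite ?mulr1 ?mulr0.
Qed.

End weighted_pushforward.

Section tuple_measure_unique.
Local Open Scope ereal_scope.
Context d (T : measurableType d) (R : realType) (n : nat).

(** Boxes are stable under intersection and generate the tuple sigma-algebra, a cylinder over one
    coordinate being a box with full sides elsewhere. The whole space is a box, so the finiteness of
    [m1] passes to [m2]. *)
Lemma tuple_measure_unique (m1 m2 : {measure set (n.-tuple T) -> \bar R}) :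
  (forall B : 'I_n -> set T, (forall i, measurable (B i)) ->
    m1 [set t | forall i, B i (tnth t i)] = m2 [set t | forall i, B i (tnth t i)]) ->
  m1 setT < +oo ->
  forall A, measurable A -> m1 A = m2 A.
Proof.
move=> m12 m1oo.
pose G : set (set (n.-tuple T)) := [set A | exists2 B : 'I_n -> set T,
  (forall i, measurable (B i)) & A = [set t | forall i, B i (tnth t i)]].
have GT : G setT.
  by exists (fun=> setT) => //; apply/seteqP; split.
move=> A mA; apply: (measure_unique G (fun=> setT)) => //.
- apply/seteqP; split.
  + apply: smallest_sub; first exact: smallest_sigma_algebra.
    move=> B; rewrite -bigcup_seq/= => -[i _ [C mC <-]].
    apply: sub_sigma_algebra.
    exists (fun j => if j == i then C else setT) => [j|]; first by case: ifP.
    apply/seteqP; split=> t /=.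
      by move=> [_ Ct] j; case: ifPn => // /eqP ->.
    by move=> /(_ i); rewrite eqxx.
  + apply: smallest_sub; first exact: sigma_algebra_measurable.
    move=> _ [B mB ->].
    rewrite (_ : [set _ | _] = \big[setI/setT]_(i < n) ((@tnth _ _ ^~ i) @^-1` B i)).
      apply: bigsetI_measurable => i _.
      by rewrite -(setTI (_ @^-1` _)); exact: measurable_tnth.
    rewrite -bigcap_seq; apply/seteqP; split=> t /=.
      by move=> H i _; exact: H.
    by move=> H i; apply: H; rewrite /= mem_index_enum.
- move=> _ _ [B mB ->] [C mC ->]; exists (fun i => B i `&` C i).
    by move=> i; exact: measurableI.
  apply/seteqP; split=> t /=; first by move=> [? ?].
  by move=> H; split=> i; have [] := H i.
- by apply/seteqP; split=> // x _; exists 0%N.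
- by move=> _ [B mB ->]; exact: m12.
Qed.

End tuple_measure_unique.

(** * Cameron-Martin formula for the noise vector *)

Section cameron_martin.
Local Open Scope ereal_scope.
Context {R : realType} {d : measure_display} {Omega : measurableType d}.
Variables (P : probability Omega R) (M : nat) (noise : Omega -> M.-tuple R).
Variables (sigma : R).
Hypotheses (sigma0 : (0 < sigma)%R) (Hnoise : gauss_noise P noise sigma).

Let mnoise : measurable_fun setT noise. Proof. by case: Hnoise. Qed.

Lemma measurable_noise i : measurable_fun setT (fun w => tnth (noise w) i).
Proof. exact: (measurableT_comp (measurable_tnth i) mnoise). Qed.

(** Induction on the number of coordinates that carry arbitrary functions. The others carry
    indicators, so that [j = 0] is the hypothesis on the noise. *)
Let prod_expectation_upto (j : nat) (f : 'I_M -> R -> R) (k : 'I_M -> R) :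
  (j <= M)%N ->
  (forall i, measurable_fun setT (f i)) -> (forall i x, (0 <= f i x)%R) ->
  (forall i, \int[normal_prob 0 sigma]_x (f i x)%:E = (k i)%:E) ->
  (forall i : 'I_M, (j <= i)%N -> exists B, measurable B /\ f i = \1_B) ->
  \int[P]_w (\prod_i f i (tnth (noise w) i))%R%:E = (\prod_i k i)%R%:E.
Proof.
elim: j f k => [|j IH] f k jM mf f0 fk fB.
  have /choice[B HB] i : exists B, measurable B /\ f i = \1_B by exact: fB.
  have [_ /(_ B)] := Hnoise.
  move=> /(_ (fun i => (HB i).1)) PB.
  transitivity (P [set w | forall i, B i (tnth (noise w) i)]); last first.
    rewrite PB; congr EFin; apply: eq_bigr => i _; have := fk i.
    have [mBi ->] := HB i.
    by rewrite integral_indic//= setIT => ->.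
  have mbox : measurable [set w | forall i, B i (tnth (noise w) i)].
    rewrite (_ : [set _ | _] =
      \big[setI/setT]_(i < M) ((fun w => tnth (noise w) i) @^-1` B i)).
      apply: bigsetI_measurable => i _; rewrite -(setTI (_ @^-1` _)).
      by apply: measurable_noise => //; exact: (HB i).1.
    rewrite -bigcap_seq; apply/seteqP; split=> t /=.
      by move=> H i _; exact: H.
    by move=> H i; apply: H; rewrite /= mem_index_enum.
  rewrite -[X in P X]setIT -integral_indic//.
  apply: eq_integral => w _; congr EFin; rewrite indicE.
  case: (boolP (w \in _)) => [|/negP]; rewrite inE/= => Bw.
    rewrite big1// => i _; have [_ ->] := HB i.
    by rewrite indicE mem_set.
  have /existsNP[i nBi] := Bw.
  rewrite (bigD1 i)//=; have [_ ->] := HB i.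
  by rewrite indicE memNset// mul0r.
pose i0 : 'I_M := Ordinal jM.
have k0 i : (0 <= k i)%R.
  by rewrite -lee_fin -fk; apply: integral_ge0 => x _; rewrite lee_fin.
have kap0 : (0 <= \prod_(i | i != i0) k i)%R by exact: prodr_ge0.
(* The law of coordinate [i0] when [P] is weighted by the other factors: with an indicator in place
   of [f i0], the induction hypothesis evaluates it as their product of means times the normal
   law. *)
pose nu := mscale (NngNum kap0) (normal_prob 0 sigma).
have mprod (g : 'I_M -> R -> R) (A : pred 'I_M) : (forall i, measurable_fun setT (g i)) ->
    measurable_fun setT (fun w => \prod_(i | A i) g i (tnth (noise w) i))%R.
  move=> mg; under eq_fun do rewrite -big_filter; apply: measurable_prod => i _.
  by apply: measurableT_comp => //; exact: measurable_noise.
transitivity (\int[P]_w ((\prod_(i | i != i0) f i (tnth (noise w) i)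
    * f i0 (tnth (noise w) i0))%R)%:E).
  by apply: eq_integral => w _; rewrite (bigD1 i0)//= mulrC.
rewrite (@ge0_integral_transfer _ _ _ _ R P nu (fun w => tnth (noise w) i0)
  (fun w => \prod_(i | i != i0) f i (tnth (noise w) i))%R)//.
- rewrite ge0_integral_mscale//=.
  + by rewrite fk -EFinM [in RHS](bigD1 i0)//= mulrC.
  + by apply/measurable_EFinP; exact: mf.
  + by move=> x _; rewrite lee_fin; exact: f0.
- exact: measurable_noise.
- exact: mprod.
- by move=> w; apply: prodr_ge0.
- move=> B mB.
  pose f' i := if i == i0 then \1_B else f i.
  pose k' i := if i == i0 then fine (normal_prob 0 sigma B) else k i.
  have := IH f' k' (ltnW jM).
  have -> : (\prod_i k' i)%R%:E = nu B.
    rewrite (bigD1 i0)//= /k' eqxx /nu /mscale/= muleC EFinM fineK.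
      by congr (_ * _); congr EFin; apply: eq_bigr => i /negbTE ->.
    by rewrite fin_num_measure.
  move=> IHB; apply: etrans (IHB _ _ _ _).
  + apply: eq_integral => w _; congr EFin; rewrite [RHS](bigD1 i0)//= {1}/f' eqxx mulrC.
    by congr (_ * _)%R; apply: eq_bigr => i /negbTE; rewrite /f' => ->.
  + by move=> i; rewrite /f'; case: ifP.
  + by move=> i x; rewrite /f'; case: ifP.
  + move=> i; rewrite /f' /k'; case: ifP => // _.
    by rewrite integral_indic//= setIT fineK// fin_num_measure.
  + move=> i ji; rewrite /f'; case: ifPn => [_|ni]; first by exists B.
    apply: fB; rewrite ltn_neqAle ji andbT.
    by apply: contra ni => /eqP e; apply/eqP/val_inj.
- exact: mf.
Qed.

Lemma gauss_prod_expectation (f : 'I_M -> R -> R) (k : 'I_M -> R) :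
  (forall i, measurable_fun setT (f i)) -> (forall i x, (0 <= f i x)%R) ->
  (forall i, \int[normal_prob 0 sigma]_x (f i x)%:E = (k i)%:E) ->
  \int[P]_w (\prod_i f i (tnth (noise w) i))%R%:E = (\prod_i k i)%R%:E.
Proof.
move=> mf f0 fk; apply: (@prod_expectation_upto M) => // i.
by rewrite leqNgt ltn_ord.
Qed.

Definition tshift (h : 'cV[R]_M) (t : M.-tuple R) : M.-tuple R :=
  [tuple (tnth t i + h i 0)%R | i < M].

Lemma measurable_tshift h : measurable_fun setT (tshift h).
Proof.
apply/measurable_fun_tnthP => i.
rewrite (_ : _ \o _ = (fun t => tnth t i + h i 0)%R); last first.
  by apply/funext => t /=; rewrite tnth_mktuple.
by apply: measurable_funD => //; exact: measurable_tnth.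
Qed.

Lemma tcol_tshift h t : tcol (tshift h t) = (h + tcol t)%R.
Proof. by apply/colP => i; rewrite !mxE tnth_mktuple addrC. Qed.

(** Density of the law of the noise translated by [h] with respect to the law of the noise. *)
Definition cmdens (h : 'cV[R]_M) (t : M.-tuple R) : R :=
  expR ((\sum_i h i 0 * tnth t i) / sigma ^+ 2 - sqnorm h / (2 * sigma ^+ 2)).

Lemma measurable_cmdens h : measurable_fun setT (cmdens h).
Proof.
apply: measurableT_comp => //; apply: measurable_funB => //.
apply: measurable_funM => //; apply: measurable_sum => i.
by apply: measurable_funM => //; exact: measurable_tnth.
Qed.

Lemma cmdensE h t : cmdens h t =
  (\prod_i expR (h i 0 * tnth t i / sigma ^+ 2 - h i 0 ^+ 2 / (2 * sigma ^+ 2)))%R.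
Proof.
rewrite -expR_sum /cmdens; congr expR.
by rewrite big_split/= sumrN -!mulr_suml.
Qed.

(** Both sides integrate [G] on tuples, against the image of [P] under the shifted noise and against
    a weighted image [wpush]. These measures agree on boxes, where the density factorises into
    one-dimensional shifts. *)
Theorem cameron_martin (h : 'cV[R]_M) (G : M.-tuple R -> R) :
  measurable_fun setT G -> (forall t, (0 <= G t)%R) ->
  \int[P]_w (G (tshift h (noise w)))%:E =
  \int[P]_w ((cmdens h (noise w) * G (noise w))%R)%:E.
Proof.
move=> mG G0.
have mw : measurable_fun setT (cmdens h \o noise).
  by apply: measurableT_comp => //; exact: measurable_cmdens.
have w0 w : (0 <= (cmdens h \o noise) w)%R by exact: expR_ge0.
have mphi : measurable_fun setT (tshift h \o noise).
  by apply: measurableT_comp => //; exact: measurable_tshift.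
have -> : \int[P]_w (G (tshift h (noise w)))%:E =
   \int[pushforward P (tshift h \o noise)]_t (G t)%:E.
  rewrite ge0_integral_pushforward ?preimage_setT//; first exact/measurable_EFinP.
  by move=> t _; rewrite lee_fin.
apply/esym.
apply: (@ge0_integral_transfer _ _ _ _ R P _ noise (cmdens h \o noise)) => //.
move=> B mB; rewrite -wpushE; apply/esym.
move: B mB; apply: tuple_measure_unique; last first.
  rewrite /= /pushforward preimage_setT probability_setT.
  exact: ltry.
move=> B mB /=.
have [_ noiseE] := Hnoise.
rewrite wpushE /pushforward.
have mB' i : measurable ((fun x => (x + h i 0)%R) @^-1` B i).
  by rewrite -(setTI (_ @^-1` _)); exact: measurable_funD.
transitivity (P [set w | forall i, ((fun x => (x + h i 0)%R) @^-1` B i) (tnth (noise w) i)]).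
  congr (P _); apply/seteqP; split=> w /= Bw i; have := Bw i; rewrite /= tnth_mktuple//.
apply: etrans (noiseE _ mB') _.
rewrite -(@gauss_prod_expectation (fun i x =>
   expR (h i 0 * x / sigma ^+ 2 - h i 0 ^+ 2 / (2 * sigma ^+ 2)) * \1_(B i) x)%R).
- apply: eq_integral => w _; congr EFin; rewrite /= cmdensE big_split/=; congr (_ * _)%R.
  rewrite indicE; case: (boolP (noise w \in _)) => [|/negP]; rewrite inE/= => Bw.
    by rewrite big1// => i _; rewrite indicE mem_set.
  have /existsNP[i nBi] := Bw.
  by rewrite (bigD1 i)//= indicE memNset// mul0r.
- move=> i; apply: measurable_funM => //; apply: measurableT_comp => //.
  apply: measurable_funB => //.
  by apply: measurable_funM => //; apply: measurable_funM.
- by move=> i x; rewrite mulr_ge0 ?expR_ge0.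
- move=> i; rewrite normal_prob_shift// fineK//; apply: fin_num_measure; exact: mB'.
Qed.

Lemma integral_cmdens h : \int[P]_w (cmdens h (noise w))%:E = 1.
Proof.
transitivity (\int[P]_w (1%R)%:E); last first.
  have := expectation_cst P 1; rewrite unlock; exact.
rewrite (@cameron_martin h (fun=> 1%R))//.
by apply: eq_integral => w _; rewrite mulr1.
Qed.

End cameron_martin.

(** * Expectations with integrability *)

Section expectation_predicate.
Context {R : realType} {d : measure_display} {Omega : measurableType d}.
Variable P : {measure set Omega -> \bar R}.

(** Integrability and value travel together, so that linear combinations leave no separate
    integrability obligations. *)
Definition has_expectation (f : Omega -> R) (v : R) : Prop :=
  P.-integrable setT (EFin \o f) /\ (\int[P]_w (f w)%:E)%E = v%:E.

Lemma has_expectation_unique f v v' :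
  has_expectation f v -> has_expectation f v' -> v = v'.
Proof. by move=> [_ e] [_]; rewrite e => -[]. Qed.

Lemma eq_has_expectation f g v v' : f =1 g -> v = v' ->
  has_expectation f v -> has_expectation g v'.
Proof. by move=> /funext -> ->. Qed.

Lemma integrable_has_expectation (f : Omega -> R) : P.-integrable setT (EFin \o f) ->
  has_expectation f (fine (\int[P]_w (f w)%:E)%E).
Proof.
move=> fi; split=> //; rewrite fineK//.
exact: (integrable_fin_num measurableT fi).
Qed.

Lemma ge0_has_expectation (f : Omega -> R) v : measurable_fun setT f -> (forall w, 0 <= f w) ->
  (\int[P]_w (f w)%:E)%E = v%:E -> has_expectation f v.
Proof.
move=> mf f0 fv; split=> //; apply/integrableP; split; first exact/measurable_EFinP.
under eq_integral do rewrite /= ger0_norm//.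
by rewrite fv ltry.
Qed.

Lemma has_expectationD f g u v : has_expectation f u -> has_expectation g v ->
  has_expectation (fun w => f w + g w) (u + v).
Proof.
move=> [fi fu] [gi gv]; split.
  exact: (integrableD measurableT fi gi).
under eq_integral do rewrite EFinD.
by rewrite (integralD measurableT fi gi) fu gv EFinD.
Qed.

Lemma has_expectationZ a f u : has_expectation f u ->
  has_expectation (fun w => a * f w) (a * u).
Proof.
move=> [fi fu]; split.
  exact: (integrableZl measurableT a fi).
under eq_integral do rewrite EFinM.
by rewrite (integralZl measurableT fi) fu EFinM.
Qed.

Lemma has_expectationN f u : has_expectation f u ->
  has_expectation (fun w => - f w) (- u).
Proof.
move=> /(has_expectationZ (-1)); apply: eq_has_expectation => [w|]; exact: mulN1r.
Qed.

Lemma has_expectationB f g u v : has_expectation f u -> has_expectation g v ->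
  has_expectation (fun w => f w - g w) (u - v).
Proof. by move=> fu /has_expectationN; exact: has_expectationD. Qed.

Lemma has_expectation0 : has_expectation (fun=> 0) 0.
Proof. by split; [exact: integrable0|rewrite integral0]. Qed.

Lemma has_expectation_sum I (r : seq I) (f : I -> Omega -> R) (u : I -> R) :
  (forall i, has_expectation (f i) (u i)) ->
  has_expectation (fun w => \sum_(i <- r) f i w) (\sum_(i <- r) u i).
Proof.
move=> fu; elim: r => [|i r IH].
  by rewrite big_nil; apply: eq_has_expectation has_expectation0 => // w; rewrite big_nil.
rewrite big_cons; apply: eq_has_expectation (has_expectationD (fu i) IH) => // w.
by rewrite big_cons.
Qed.

Lemma has_expectation_ge0 (f : Omega -> R) u :
  (forall w, 0 <= f w) -> has_expectation f u -> 0 <= u.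
Proof.
by move=> f0 [_ fu]; rewrite -lee_fin -fu; apply: integral_ge0 => w _; rewrite lee_fin.
Qed.

Lemma dominated_integrable (f g : Omega -> R) u : measurable_fun setT f -> has_expectation g u ->
  (forall w, `|f w| <= g w) -> P.-integrable setT (EFin \o f).
Proof.
move=> mf [gi _] fg; apply: (le_integrable measurableT _ _ gi); first exact/measurable_EFinP.
by move=> w _ /=; rewrite lee_fin (le_trans (fg w))// ler_norm.
Qed.

End expectation_predicate.

(** * Algebra of Hermite polynomials and Gaussian moments *)

Section hermite_polynomials.
Context {R : realType}.

(** Probabilists' normalisation, orthogonal for the standard normal law. *)
Fixpoint hermite (k : nat) : {poly R} :=
  if k is j.+1 then 'X * hermite j - (hermite j)^`() else 1.

(* The k-th derivative of exp (t^2/2) is (gauss_dpoly k).[t] * exp (t^2/2); by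
   differentiating the moment generating function, it is also E [Z^k exp (t Z)]
   for a standard Gaussian Z. *)
Fixpoint gauss_dpoly (k : nat) : {poly R} :=
  if k is j.+1 then 'X * gauss_dpoly j + (gauss_dpoly j)^`() else 1.

Lemma hermiteS k : hermite k.+1 = 'X * hermite k - (hermite k)^`().
Proof. by []. Qed.

Lemma deriv_hermite k : (hermite k.+1)^`() = hermite k *+ k.+1.
Proof.
elim: k => [|k IH]; first by rewrite /= derivB derivM derivX !derivC subr0 mulr0 addr0 mulr1.
rewrite hermiteS derivB derivM derivX mul1r IH derivMn mulrnAr -addrA -mulrnBl.
by rewrite -hermiteS [in RHS]mulrS.
Qed.

Lemma gauss_dpolyS k : gauss_dpoly k.+1 = 'X * gauss_dpoly k + (gauss_dpoly k)^`().
Proof. by []. Qed.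

Lemma deriv_gauss_dpoly k : (gauss_dpoly k.+1)^`() = gauss_dpoly k *+ k.+1.
Proof.
elim: k => [|k IH]; first by rewrite /= derivD derivM derivX !derivC addr0 mulr0 addr0 mulr1.
rewrite gauss_dpolyS derivD derivM derivX mul1r IH derivMn mulrnAr -addrA -mulrnDl.
by rewrite -gauss_dpolyS [in RHS]mulrS.
Qed.

Definition gauss_moment (k : nat) (t : R) : R :=
  (gauss_dpoly k).[t] * expR (t ^+ 2 / 2).

Lemma is_derive_gauss_moment k (t : R) :
  is_derive t 1 (gauss_moment k) (gauss_moment k.+1 t).
Proof.
have h1 : is_derive t 1 (fun t : R => t ^+ 2 / 2) t.
  by apply: is_derive_eq; rewrite /GRing.scale/=; field.
have h2 : is_derive t 1 (fun t : R => expR (t ^+ 2 / 2)) (t * expR (t ^+ 2 / 2)).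
  by apply: (is_derive_eq (@is_derive1_comp R expR _ t _ _ (is_derive_expR _) h1)); rewrite mulrC.
rewrite /gauss_moment; apply: is_derive_eq.
rewrite /GRing.scale/= hornerD hornerM hornerX; ring.
Qed.

Lemma gauss_momentSS k t :
  gauss_moment k.+2 t = t * gauss_moment k.+1 t + k.+1%:R * gauss_moment k t.
Proof.
rewrite /gauss_moment gauss_dpolyS hornerD deriv_gauss_dpoly hornerM hornerX hornerMn.
by rewrite -mulr_natl; ring.
Qed.

(** The value of E [q(Z) exp (t Z)] for a standard Gaussian Z, defined from the moments alone. The
    Hermite identities become polynomial algebra, and the link with a probability is made once, in
    [gauss_poly_expectation]. *)
Definition gauss_functional (t : R) (q : {poly R}) : R :=
  \sum_(k < size q) q`_k * gauss_moment k t.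

Lemma gauss_functionalE n t (q : {poly R}) : (size q <= n)%N ->
  gauss_functional t q = \sum_(k < n) q`_k * gauss_moment k t.
Proof.
move=> qn; rewrite /gauss_functional (big_ord_widen _ (fun k => q`_k * gauss_moment k t) qn).
rewrite big_mkcond/=; apply: eq_bigr => k _; case: ltnP => // kq.
by rewrite nth_default// mul0r.
Qed.

Lemma gauss_functionalD t p q :
  gauss_functional t (p + q) = gauss_functional t p + gauss_functional t q.
Proof.
pose n := maxn (size p) (size q).
rewrite !(@gauss_functionalE n) ?leq_maxl ?leq_maxr ?size_polyD//.
by rewrite -big_split/=; apply: eq_bigr => k _; rewrite coefD mulrDl.
Qed.

Lemma gauss_functionalZ t a p : gauss_functional t (a *: p) = a * gauss_functional t p.
Proof.
rewrite (@gauss_functionalE (size p)) ?size_scale_leq// mulr_sumr.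
by apply: eq_bigr => k _; rewrite coefZ mulrA.
Qed.

Lemma gauss_functionalN t p : gauss_functional t (- p) = - gauss_functional t p.
Proof. by rewrite -scaleN1r gauss_functionalZ mulN1r. Qed.

Lemma gauss_functional1 t : gauss_functional t 1 = expR (t ^+ 2 / 2).
Proof.
by rewrite /gauss_functional size_poly1 big_ord1 coef1 /gauss_moment hornerC !mul1r.
Qed.

(** Gaussian integration by parts: the derivative of q(z) exp (t z) is (q' + t q)(z) exp (t z). On
    coefficients it is the recurrence [gauss_momentSS]. *)
Lemma gauss_functionalX t q : gauss_functional t ('X * q) =
  t * gauss_functional t q + gauss_functional t q^`().
Proof.
pose n := size q.
rewrite (@gauss_functionalE n.+1 t ('X * q)); last first.
  by rewrite (leq_trans (size_polyMleq _ _))// size_polyX.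
rewrite big_ord_recl coefXM eqxx mul0r add0r.
under eq_bigr do rewrite coefXM/= /bump/= add1n/=.
rewrite (@gauss_functionalE n t q)// (@gauss_functionalE n t q^`()); last first.
  by apply/leq_sizeP => j nj; rewrite coef_deriv nth_default ?mul0rn// leqW.
(* The lowering terms. [G] vanishes at [0] and at [n], so its sum can be re-indexed over the
   coefficients of the derivative. *)
pose G k := q`_k * k%:R * gauss_moment k.-1 t.
have GS : \sum_(k < n) G k = \sum_(k < n) q^`()`_k * gauss_moment k t.
  transitivity (\sum_(k < n.+1) G k).
    by rewrite big_ord_recr/= {3}/G nth_default// !mul0r addr0.
  rewrite big_ord_recl {1}/G mulr0 mul0r add0r.
  apply: eq_bigr => k _; rewrite /G /bump/= coef_deriv.
  by rewrite mulr_natr.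
rewrite -GS mulr_sumr -big_split/=; apply: eq_bigr => -[[|k] kn] _ /=.
  have -> : gauss_moment 1 t = t * gauss_moment 0 t.
    rewrite /gauss_moment gauss_dpolyS (_ : (gauss_dpoly 0)^`() = 0); last exact: derivC.
    by rewrite addr0 hornerM hornerX mulrA.
  by rewrite /G mulr0 mul0r addr0; ring.
by rewrite gauss_momentSS /G/=; ring.
Qed.

(** Integration by parts cancels the derivative of [hermite k] in the recursion and leaves one
    falling on [q]. *)
Lemma gauss_functional_hermiteS t k q : gauss_functional t (hermite k.+1 * q) =
  t * gauss_functional t (hermite k * q) + gauss_functional t (hermite k * q^`()).
Proof.
rewrite /= mulrBl gauss_functionalD gauss_functionalN -mulrA gauss_functionalX derivM.
by rewrite gauss_functionalD; ring.
Qed.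

Lemma gauss_functional_hermite t k :
  gauss_functional t (hermite k) = t ^+ k * expR (t ^+ 2 / 2).
Proof.
elim: k => [|k IH]; first by rewrite gauss_functional1 mul1r.
rewrite -[hermite _]mulr1 gauss_functional_hermiteS derivC mulr0 mulr1 IH.
by rewrite /gauss_functional size_poly0 big_ord0 addr0 mulrA -exprS.
Qed.

(** At [t = 0] each index of the first factor differentiates the second once, so both indices
    descend together. Unequal indices end on the derivative of a constant or on the mean of a
    nonconstant Hermite polynomial. *)
Lemma gauss_functional_hermiteM k j :
  gauss_functional 0 (hermite k * hermite j) = if k == j then k`!%:R else 0.
Proof.
elim: k j => [|k IH] j.
  rewrite mul1r gauss_functional_hermite (expr0n _ 2)/= mul0r expR0 mulr1 expr0n eq_sym.
  by case: eqP.
rewrite gauss_functional_hermiteS mul0r add0r.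
case: j => [|j].
  by rewrite derivC mulr0 /gauss_functional size_poly0 big_ord0.
rewrite deriv_hermite mulrnAr -scaler_nat gauss_functionalZ IH eqSS.
by case: eqP => [<-|_]; rewrite ?mulr0// factS natrM.
Qed.

End hermite_polynomials.

(** * Gaussian moments from the moment generating function *)

Section gaussian_moments.
Context {R : realType} {d : measure_display} {Omega : measurableType d}.
Variables (P : probability Omega R) (D : nat) (w : 'I_D -> Omega -> R).
Hypothesis mw : forall l, measurable_fun setT (w l).
Hypothesis mgf : forall t : 'I_D -> R,
  (\int[P]_x (expR (\sum_l t l * w l x))%:E)%E = (expR (\sum_l t l ^+ 2 / 2))%:E.

Let mono (k : 'I_D -> nat) (t : 'I_D -> R) (x : Omega) : R :=
  \prod_l (w l x ^+ k l * expR (t l * w l x)).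

Let mmono k t : measurable_fun setT (mono k t).
Proof.
apply: measurable_prod => l _; apply: measurable_funM.
  exact: measurable_funX.
by apply: measurableT_comp => //; exact: measurable_funM.
Qed.

Let expect_exp t : has_expectation P (fun x => expR (\sum_l t l * w l x))
  (expR (\sum_l t l ^+ 2 / 2)).
Proof.
apply: ge0_has_expectation => [|x|]; last exact: mgf.
- apply: measurableT_comp => //; apply: measurable_sum => l.
  exact: measurable_funM.
- exact: expR_ge0.
Qed.

(** Dominating function: the product is at least exp (c sum_l |w_l|), and it expands into 2^D
    exponentials, each integrable by [mgf]. *)
Let dom (C c : R) (x : Omega) : R :=
  C * \prod_l (expR (c * w l x) + expR (- c * w l x)).

Let dom_integrable C c : exists u, has_expectation P (dom C c) u.
Proof.
pose t (f : {ffun 'I_D -> bool}) l : R := if f l then c else - c.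
exists (C * \sum_(f : {ffun 'I_D -> bool}) expR (\sum_l t f l ^+ 2 / 2)).
apply: has_expectationZ.
have := has_expectation_sum (index_enum {ffun 'I_D -> bool}) (fun f => expect_exp (t f)).
apply: eq_has_expectation => // x.
under [in RHS]eq_bigr => l _.
  rewrite (_ : _ + _ = \sum_(b : bool) expR ((if b then c else - c) * w l x)); last first.
    by rewrite big_bool.
  over.
rewrite bigA_distr_bigA/=; apply: eq_bigr => f _.
by rewrite expR_sum.
Qed.

(** This is u <= exp u at u = |x| / k, raised to the power k. *)
Let pow_le_expR (x : R) (k : nat) : `|x| ^+ k <= k%:R ^+ k * expR `|x|.
Proof.
have [->|k0] := eqVneq k 0%N; first by rewrite !expr0 mul1r -expR0 ler_expR.
have k0' : 0 < k%:R :> R by rewrite ltr0n lt0n.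
have -> : expR `|x| = expR (`|x| / k%:R) ^+ k.
  by rewrite -expRM_natl mulrC divfK// gt_eqF.
rewrite -exprMn; apply: lerXn2r; rewrite ?nnegrE ?mulr_ge0 ?expR_ge0//.
rewrite mulrC -ler_pdivrMr//; apply: le_trans (expR_ge1Dx _).
by rewrite lerDr.
Qed.

Let expR_abs_le (a c x : R) : `|a| <= c -> expR (a * x) <= expR (c * `|x|).
Proof.
move=> ac; rewrite ler_expR (le_trans (ler_norm _))// normrM.
by rewrite ler_wpM2r.
Qed.

(** The polynomial factor costs one extra unit in the exponent, hence [c + 1]. *)
Let mono_dom (k : 'I_D -> nat) t c x : (forall l, `|t l| <= c) ->
  `|mono k t x| <= dom (\prod_l (k l)%:R ^+ k l) (c + 1) x.
Proof.
move=> tc; rewrite /mono /dom normr_prod -big_split/=; apply: ler_prod => l _.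
rewrite normr_ge0/= normrM normrX [X in _ * X]ger0_norm ?expR_ge0//.
apply: le_trans (ler_pM _ _ (pow_le_expR (w l x) (k l)) (expR_abs_le (w l x) (tc l))) _;
  rewrite ?exprn_ge0 ?expR_ge0//.
rewrite -mulrA ler_wpM2l ?exprn_ge0// -expRD.
rewrite -[X in X + _]mul1r -mulrDl addrC.
have [w0|w0] := leP 0 (w l x).
  by rewrite ger0_norm// lerDl expR_ge0.
by rewrite ltr0_norm// mulrN -mulNr lerDr expR_ge0.
Qed.

Let mono_integrable k t : P.-integrable setT (EFin \o mono k t).
Proof.
pose c := \sum_l `|t l|.
have [u du] := dom_integrable (\prod_l (k l)%:R ^+ k l) (c + 1).
apply: (dominated_integrable (mmono k t) du) => x.
apply: mono_dom => l; rewrite /c (bigD1 l)//= lerDl.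
by apply: sumr_ge0.
Qed.

Let upd (t : 'I_D -> R) l (a : R) : 'I_D -> R := fun i => if i == l then a else t i.

Let mono_upd k t l a x : mono k (upd t l a) x =
  (\prod_(i | i != l) (w i x ^+ k i * expR (t i * w i x)) * w l x ^+ k l) *
  expR (w l x * a).
Proof.
rewrite /mono (bigD1 l)//= {1}/upd eqxx mulrC (mulrC a) mulrA; congr (_ * _ * _).
by apply: eq_bigr => i /negbTE il; rewrite /upd il.
Qed.

Let mono_updS k t l a x : mono (fun i => (k i + (i == l))%N) (upd t l a) x =
  w l x * mono k (upd t l a) x.
Proof.
rewrite !mono_upd eqxx addn1 exprSr.
under eq_bigr => i /negbTE il do rewrite il addn0.
by ring.
Qed.

Let is_derive_mono k t l (a : R) x :
  is_derive a 1 (fun a => mono k (upd t l a) x) (w l x * mono k (upd t l a) x).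
Proof.
have -> : (fun a => mono k (upd t l a) x) = (fun a =>
   (\prod_(i | i != l) (w i x ^+ k i * expR (t i * w i x)) * w l x ^+ k l) *
  expR (w l x * a)).
  by apply/funext => b; rewrite mono_upd.
rewrite mono_upd; set c := (X in X * expR _).
have h1 : is_derive a 1 (fun a : R => w l x * a) (w l x).
  by apply: is_derive_eq; rewrite /GRing.scale/=; ring.
have h2 := @is_derive1_comp R expR _ a _ _ (is_derive_expR _) h1.
have h3 := is_deriveZ c h2.
apply: (is_derive_eq h3); rewrite /GRing.scale/=; ring.
Qed.

Let differentiate k t l (a : R) :
  is_derive a 1 (fun a => \int[P]_x mono k (upd t l a) x)
    (\int[P]_x mono (fun i => (k i + (i == l))%N) (upd t l a) x).
Proof.
(* Bounds every exponent while the [l]-th one ranges over the open interval of radius 1 around [a],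
   so that one function dominates all the derivatives there. *)
pose c := `|a| + 1 + \sum_l `|t l|.
pose k' i := (k i + (i == l))%N.
have [u du] := dom_integrable (\prod_l (k' l)%:R ^+ k' l) (c + 1).
have Ia : `]a - 1, a + 1[%classic a.
  by rewrite /= in_itv/= ltrBlDr !ltrDl ltr01.
have d1E b x : partial1of2 (fun b => mono k (upd t l b)) b x = mono k' (upd t l b) x.
  by rewrite partial1of2E mono_updS; apply: derive_val; exact: is_derive_mono.
have derf b x : `]a - 1, a + 1[%classic b -> [set: Omega] x ->
    derivable (fun b => mono k (upd t l b) x) b 1.
  by move=> _ _; apply: ex_derive; exact: is_derive_mono.
have G0 x : 0 <= dom (\prod_l (k' l)%:R ^+ k' l) (c + 1) x.
  apply: mulr_ge0; apply: prodr_ge0 => i _; first by rewrite exprn_ge0.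
  by rewrite addr_ge0 ?expR_ge0.
have Gub b x : `]a - 1, a + 1[%classic b -> [set: Omega] x ->
    `|partial1of2 (fun b => mono k (upd t l b)) b x| <=
    dom (\prod_l (k' l)%:R ^+ k' l) (c + 1) x.
  rewrite /= in_itv/= => /andP[b1 b2] _; rewrite d1E; apply: mono_dom => i.
  have S0 : 0 <= \sum_l `|t l| by apply: sumr_ge0.
  rewrite /upd; case: ifP => _.
    apply: (@le_trans _ _ (`|a| + 1)); last by rewrite lerDl.
    rewrite ler_norml.
    have := ler_norm a; have := ler_norm (- a); rewrite normrN.
    by move=> ? ?; apply/andP; split; lra.
  apply: (@le_trans _ _ (\sum_l `|t l|)); last by rewrite lerDr addr_ge0.
  by rewrite (bigD1 i)//= lerDl sumr_ge0.
have intf b : `]a - 1, a + 1[%classic b -> P.-integrable setT (EFin \o mono k (upd t l b)).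
  by move=> _; exact: mono_integrable.
have D1 := @derivable_under_integral _ _ _ P (fun b => mono k (upd t l b)) setT
  measurableT a (a - 1) (a + 1) Ia intf derf _ G0 du.1 Gub.
have D2 := @differentiation_under_integral _ _ _ P (fun b => mono k (upd t l b)) setT
  measurableT a (a - 1) (a + 1) Ia intf derf _ G0 du.1 Gub.
apply: DeriveDef => //.
rewrite -derive1E D2; congr Rintegral.
by apply/funext => x; rewrite d1E.
Qed.

(** Induction on the total degree: degree zero is [mgf], and a power of [w l] is gained by
    differentiating in [t l]. *)
Lemma gauss_monomial_expectation (k : 'I_D -> nat) (t : 'I_D -> R) :
  has_expectation P (fun x => \prod_l (w l x ^+ k l * expR (t l * w l x)))
    (\prod_l gauss_moment (k l) (t l)).
Proof.
suff H n : forall k t, (\sum_l k l = n)%N ->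
    \int[P]_x mono k t x = \prod_l gauss_moment (k l) (t l).
  split; first exact: mono_integrable.
  by rewrite -(H _ k t erefl) fineK//; exact: (integrable_fin_num measurableT (mono_integrable k t)).
elim: n => [|n IH] {}k {}t kn.
  have k0 l : k l = 0%N.
    by move/eqP: kn; rewrite sum_nat_eq0 => /forallP/(_ l)/eqP.
  have [_ e] := expect_exp t.
  transitivity (fine (\int[P]_x (expR (\sum_l t l * w l x))%:E)).
    congr fine; apply: eq_integral => x _; rewrite /mono expR_sum; congr EFin.
    by apply: eq_bigr => l _; rewrite k0 expr0 mul1r.
  rewrite e/= expR_sum; apply: eq_bigr => l _.
  by rewrite k0 /gauss_moment hornerC mul1r.
have [l kl] : exists l, (0 < k l)%N.
  apply/existsP; rewrite -[X in is_true X]negbK negb_exists; apply/negP => /forallP k0.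
  move: kn; rewrite big1// => l _; apply/eqP.
  by have := k0 l; rewrite -eqn0Ngt.
pose k' i := (k i - (i == l))%N.
have kE : k = fun i => (k' i + (i == l))%N.
  apply/funext => i; rewrite /k'; case: eqP => [->|_]; last by rewrite subn0 addn0.
  by rewrite subnK.
have k'n : (\sum_l k' l = n)%N.
  move: kn; rewrite {1}kE big_split/=.
  have -> : (\sum_(i < D) (i == l) = 1)%N.
    by rewrite (bigD1 l)//= eqxx big1// => i /negbTE ->.
  by rewrite addn1 => -[].
have tE : t = upd t l (t l) by apply/funext => i; rewrite /upd; case: eqP => [->|].
have E1 : \int[P]_x mono k t x =
    \int[P]_x mono (fun i => (k' i + (i == l))%N) (upd t l (t l)) x.
  by rewrite -kE -tE.
rewrite E1.
have [_ <-] := differentiate k' t l (t l).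
(* The integral sought is now a derivative in [a], and the induction hypothesis makes the function
   being differentiated explicit. *)
have -> : (fun a => \int[P]_x mono k' (upd t l a) x) = (fun a =>
    \prod_(i | i != l) gauss_moment (k' i) (t i) *: gauss_moment (k' l) a).
  apply/funext => a; rewrite IH// (bigD1 l)//= {1}/upd eqxx mulrC; congr (_ * _).
  by apply: eq_bigr => i /negbTE il; rewrite /upd il.
have [_ ->] := is_deriveZ (\prod_(i | i != l) gauss_moment (k' i) (t i))
  (is_derive_gauss_moment (k' l) (t l)).
rewrite [RHS](bigD1 l)//= mulrC; congr (_ * _).
  by apply: eq_bigr => i /negbTE il; rewrite [in RHS]kE /= il addn0.
by rewrite [in RHS]kE /= eqxx addn1.
Qed.

Lemma gauss_poly_expectation (q : 'I_D -> {poly R}) (t : 'I_D -> R) :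
  has_expectation P (fun x => \prod_l ((q l).[w l x] * expR (t l * w l x)))
    (\prod_l gauss_functional (t l) (q l)).
Proof.
pose n := \max_l size (q l).
have qn l : (size (q l) <= n)%N by exact: (leq_bigmax l).
pose c (f : {ffun 'I_D -> 'I_n}) := \prod_l (q l)`_(f l).
have H := has_expectation_sum (index_enum {ffun 'I_D -> 'I_n}) (fun f : {ffun 'I_D -> 'I_n} =>
  has_expectationZ (c f) (gauss_monomial_expectation (fun l => f l) t)).
apply: eq_has_expectation H => [x|]; last first.
  under [in RHS]eq_bigr do rewrite (gauss_functionalE _ (qn _)).
  rewrite bigA_distr_bigA/=; apply: eq_bigr => f _.
  by rewrite /c -big_split.
under [in RHS]eq_bigr => l _ do rewrite (horner_coef_wide _ (qn l)) mulr_suml.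
rewrite bigA_distr_bigA/=; apply: eq_bigr => f _.
by rewrite /c -big_split/=; apply: eq_bigr => l _; rewrite mulrA.
Qed.

End gaussian_moments.

(** * Mixed derivatives of products of one-variable functions *)

Section product_derivatives.
Context {R : realType} (D : nat).

Lemma partial_prod (phi : 'I_D -> R -> R) (dphi : R -> R) (c : R) (l : 'I_D) :
  (forall x : R, is_derive x 1 (phi l) (dphi x)) ->
  partial l (fun z : 'cV[R]_D => c * \prod_i phi i (z i 0)) =
  (fun z : 'cV[R]_D => c * \prod_i (if i == l then dphi else phi i) (z i 0)).
Proof.
move=> dl; apply/funext => z.
pose K := c * \prod_(i | i != l) phi i (z i 0).
have fE (h : R) : c * \prod_i phi i ((h *: delta_mx l 0 + z) i 0) =
    K * phi l (h + z l 0).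
  rewrite (bigD1 l)//= !mxE !eqxx mulr1 mulrA mulrAC; congr (_ * _ * _).
  by apply: eq_bigr => i /negbTE il; rewrite !mxE il mulr0 add0r.
have f0 : c * \prod_i phi i (z i 0) = K * phi l (z l 0).
  by have := fE 0; rewrite scale0r !add0r.
(* Along a basis vector only one factor moves, so the difference quotient is that of a function of
   one variable. *)
transitivity ('D_1 (fun x : R => K *: phi l x) (z l 0)).
  rewrite /partial /derive.
  set F := (X in lim (X @ _) = _); set G := (X in _ = lim (X @ _)).
  suff -> : F = G by [].
  by apply/funext => h; rewrite /F /G /= f0 fE /GRing.scale/= mulr1.
have [_ ->] := is_deriveZ K (dl (z l 0)).
rewrite (bigD1 l)//= eqxx /GRing.scale/= /K mulrAC mulrA; congr (_ * _ * _).
by apply: eq_bigr => i /negbTE ->.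
Qed.

Variables (phi : 'I_D -> nat -> R -> R).
Hypothesis dphi : forall i k (x : R), is_derive x 1 (phi i k) (phi i k.+1 x).

Let iter_partial_prod c l n (k : 'I_D -> nat) :
  iter n (partial l) (fun z : 'cV[R]_D => c * \prod_i phi i (k i) (z i 0)) =
  (fun z : 'cV[R]_D => c * \prod_i phi i (if i == l then n + k i else k i)%N (z i 0)).
Proof.
elim: n => [|n IH] /=; first by apply/funext => z; under [in RHS]eq_bigr do rewrite if_same.
have dl (x : R) : is_derive x 1 (phi l (if l == l then n + k l else k l)%N)
    (phi l (n + k l).+1 x) by rewrite eqxx.
rewrite IH; apply: etrans (@partial_prod (fun i => phi i (if i == l then n + k i else k i)%N)
  (phi l (n + k l).+1) c l dl) _.
apply/funext => z; congr (_ * _); apply: eq_bigr => i _.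
by case: eqP => // ->.
Qed.

(** [phi i k] stands for the k-th derivative of the i-th factor, and partial derivatives act factor
    by factor. *)
Lemma mderiv_prod c (p : mindex D) :
  mderiv p (fun z : 'cV[R]_D => c * \prod_i phi i 0%N (z i 0)) =
  (fun z : 'cV[R]_D => c * \prod_i phi i (p i) (z i 0)).
Proof.
rewrite /mderiv.
(* Generalised to any duplicate-free list of variables, so that each variable receives its
   derivatives exactly once. *)
have H (s : seq 'I_D) : uniq s ->
    foldr (fun l h => iter (p l) (partial l) h)
      (fun z : 'cV[R]_D => c * \prod_i phi i 0%N (z i 0)) s =
    (fun z : 'cV[R]_D => c * \prod_i phi i (if i \in s then p i else 0)%N (z i 0)).
  elim: s => [|l s IH]//= /andP[ls us].
  rewrite IH// iter_partial_prod; apply/funext => z; congr (_ * _); apply: eq_bigr => i _.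
  rewrite inE; case: eqP => [->|_] //=.
  by rewrite (negbTE ls) addn0.
rewrite H ?enum_uniq//; apply/funext => z; congr (_ * _); apply: eq_bigr => i _.
by rewrite mem_enum.
Qed.

End product_derivatives.

(** * Cauchy-Schwarz, box sums and minimal norm in l2 *)

Lemma discriminant_le (R : realType) (A B C : R) : 0 <= C ->
  (forall t : R, 0 <= A + 2 * t * B + t ^+ 2 * C) -> B ^+ 2 <= A * C.
Proof.
move=> C0 H; have [Ce|CN] := eqVneq C 0.
  have [->|BN] := eqVneq B 0; first by rewrite Ce mulr0 expr0n.
  (* Without quadratic term, this argument gives the affine function the value -1. *)
  have := H (- (A + 1) / (2 * B)); rewrite Ce mulr0 addr0.
  have -> : A + 2 * (- (A + 1) / (2 * B)) * B = -1 by field.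
  by rewrite ler0N1.
have Cp : 0 < C by rewrite lt0r CN.
have := H (- B / C).
have -> : A + 2 * (- B / C) * B + (- B / C) ^+ 2 * C = (A * C - B ^+ 2) / C by field.
by rewrite pmulr_lge0 ?invr_gt0// subr_ge0.
Qed.

Lemma CauchySchwarz_sum (R : realType) (I : Type) (r : seq I) (f g : I -> R) :
  (\sum_(i <- r) f i * g i) ^+ 2 <= (\sum_(i <- r) f i ^+ 2) * (\sum_(i <- r) g i ^+ 2).
Proof.
apply: discriminant_le => [|t]; first by apply: sumr_ge0 => i _; exact: sqr_ge0.
rewrite !mulr_sumr -!big_split/=; apply: sumr_ge0 => i _.
have -> : f i ^+ 2 + 2 * t * (f i * g i) + t ^+ 2 * g i ^+ 2 = (f i + t * g i) ^+ 2 by ring.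
exact: sqr_ge0.
Qed.

Lemma ler_sum_subseq (R : realType) (I : eqType) (s1 s2 : seq I) (f : I -> R) :
  (forall i, 0 <= f i) -> uniq s1 -> {subset s1 <= s2} ->
  \sum_(i <- s1) f i <= \sum_(i <- s2) f i.
Proof.
move=> f0; elim: s1 s2 => [|i s1 IH] s2 /=; first by rewrite big_nil => _ _; apply: sumr_ge0.
move=> /andP[is1 us1] ss; have is2 : i \in s2 by apply: ss; rewrite mem_head.
rewrite big_cons (big_rem i is2)/= lerD2l; apply: IH => // j js1.
have := ss j; rewrite in_cons js1 orbT => /(_ isT).
rewrite (perm_mem (perm_to_rem is2)) in_cons => /orP[/eqP ji|//].
by rewrite -ji js1 in is1.
Qed.

Section box_sums.
Context {R : realType} (D : nat).
Implicit Types (f g a b : mindex D -> R).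

(** The partial sums of [L2_series_limit]. Indexed by one integer, they reduce unordered sums to
    limits of ordinary sequences. *)
Definition bsum f (K : nat) : R :=
  \sum_(q : {ffun 'I_D -> 'I_K.+1}) f [ffun l => val (q l)].

Let box K : seq (mindex D) :=
  [seq ([ffun l => val (q l)] : mindex D) | q : {ffun 'I_D -> 'I_K.+1}].

Let bsumE f K : bsum f K = \sum_(p <- box K) f p.
Proof. by rewrite /bsum /box big_image. Qed.

Let box_uniq K : uniq (box K).
Proof.
rewrite map_inj_uniq ?enum_uniq// => q q' /ffunP e; apply/ffunP => l.
by have := e l; rewrite !ffunE => /val_inj.
Qed.

Let in_box K p : (p \in box K) = [forall l, (p l <= K)%N].
Proof.
apply/mapP/forallP => [[q _ ->] l|pK]; first by rewrite ffunE -ltnS ltn_ord.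
exists [ffun l => inord (p l)]; first by rewrite mem_enum.
by apply/ffunP => l; rewrite !ffunE/= inordK// ltnS.
Qed.

Lemma bsum_single f K (p : mindex D) : (forall l, (p l <= K)%N) ->
  (forall q, q != p -> f q = 0) -> bsum f K = f p.
Proof.
move=> pK f0; rewrite bsumE (bigD1_seq p)//= ?in_box; last exact/forallP.
by rewrite big1 ?addr0// => q; exact: f0.
Qed.

Lemma bsum_nd f : (forall p, 0 <= f p) -> nondecreasing_seq (bsum f).
Proof.
move=> f0 K K' KK'; rewrite !bsumE; apply: ler_sum_subseq => // p.
rewrite !in_box => /forallP pK; apply/forallP => l.
exact: leq_trans (pK l) KK'.
Qed.

Lemma bsumD f g K : bsum (fun p => f p + g p) K = bsum f K + bsum g K.
Proof. by rewrite /bsum big_split. Qed.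

Lemma bsumZ c f K : bsum (fun p => c * f p) K = c * bsum f K.
Proof. by rewrite /bsum mulr_sumr. Qed.

Lemma bsum_ge0 f K : (forall p, 0 <= f p) -> 0 <= bsum f K.
Proof. by move=> f0; apply: sumr_ge0. Qed.

Lemma ler_bsum f g K : (forall p, f p <= g p) -> bsum f K <= bsum g K.
Proof. by move=> fg; apply: ler_sum. Qed.

Lemma eq_bsum f g K : f =1 g -> bsum f K = bsum g K.
Proof. by move=> /funext ->. Qed.

Lemma bsum_CauchySchwarz a b K :
  bsum (fun p => a p * b p) K ^+ 2 <=
  bsum (fun p => a p ^+ 2) K * bsum (fun p => b p ^+ 2) K.
Proof. exact: CauchySchwarz_sum. Qed.

Let esum_le f C : (forall p, 0 <= f p) -> (forall K, bsum f K <= C) ->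
  (\esum_(p in [set: mindex D]) (f p)%:E <= C%:E)%E.
Proof.
move=> f0 fC; apply: ge_ereal_sup => _ [A [finA _] <-].
rewrite fsbig_finite//= sumEFin lee_fin.
(* The largest entry of any multi-index in the finite set [A], so that the box of this size contains
   [A]. *)
pose K := \max_(p <- finmap.enum_fset (fset_set A)) \max_l p l.
apply: le_trans (fC K); rewrite bsumE.
apply: ler_sum_subseq => //; first exact: finmap.fset_uniq.
move=> p pA.
rewrite in_box; apply/forallP => l; rewrite /K (big_rem p pA)/=.
by rewrite leq_max (leq_bigmax l).
Qed.

Let esum_ge_bsum f K : (forall p, 0 <= f p) ->
  ((bsum f K)%:E <= \esum_(p in [set: mindex D]) (f p)%:E)%E.
Proof.
move=> f0; apply: esum_ge; exists [set` box K].
  by split => //; exact: finite_seq.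
by rewrite -fsbig_seq ?box_uniq// bsumE sumEFin.
Qed.

Lemma esum_finite f : (forall p, 0 <= f p) ->
  (\esum_(p in [set: mindex D]) (f p)%:E < +oo)%E <->
  exists C, forall K, bsum f K <= C.
Proof.
move=> f0; split=> [fin|[C /(esum_le f0) fC]]; last by rewrite (le_lt_trans fC)// ltry.
exists (fine (\esum_(p in [set: mindex D]) (f p)%:E)) => K.
rewrite -lee_fin fineK ?esum_ge_bsum//.
by rewrite ge0_fin_numE//; apply: esum_ge0 => p _; rewrite lee_fin.
Qed.

Lemma cvg_bsum_esum f C : (forall p, 0 <= f p) -> (forall K, bsum f K <= C) ->
  bsum f K @[K --> \oo] --> fine (\esum_(p in [set: mindex D]) (f p)%:E).
Proof.
move=> f0 fC.
have cf : cvgn (bsum f).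
  apply: nondecreasing_is_cvgn; first exact: bsum_nd.
  by exists C => _ [K _ <-].
suff <- : limn (bsum f) = fine (\esum_(p in [set: mindex D]) (f p)%:E) by [].
have fin : (\esum_(p in [set: mindex D]) (f p)%:E)%E \is a fin_num.
  rewrite ge0_fin_numE; first by apply/esum_finite => //; exists C.
  by apply: esum_ge0 => p _; rewrite lee_fin.
apply/eqP; rewrite eq_le; apply/andP; split.
  apply: limr_le => //; apply: nearW => K.
  by rewrite -lee_fin fineK ?esum_ge_bsum.
rewrite -lee_fin fineK//; apply: esum_le => // K.
exact: nondecreasing_cvgn_le (bsum_nd f0) cf K.
Qed.

Lemma bsum_le_esum f C K : (forall p, 0 <= f p) -> (forall K, bsum f K <= C) ->
  bsum f K <= fine (\esum_(p in [set: mindex D]) (f p)%:E).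
Proof.
move=> f0 fC; have cf := cvg_bsum_esum f0 fC.
rewrite -(cvg_lim (@Rhausdorff R) cf).
by apply: nondecreasing_cvgn_le; [exact: bsum_nd|apply/cvg_ex; eexists; exact: cf].
Qed.

(** Absolute summability makes the positive and negative parts finite, so neither [fine] in [usum]
    hides an infinite sum. *)
Lemma cvg_bsum_usum f C : (forall K, bsum (fun p => `|f p|) K <= C) ->
  bsum f K @[K --> \oo] --> usum f.
Proof.
move=> fC.
pose fp p := Num.max (f p) 0; pose fn p := Num.max (- f p) 0.
have fpC K : bsum fp K <= C.
  apply: le_trans (fC K); apply: ler_bsum => p; rewrite /fp ge_max normr_ge0 andbT.
  exact: ler_norm.
have fnC K : bsum fn K <= C.
  apply: le_trans (fC K); apply: ler_bsum => p; rewrite /fn ge_max normr_ge0 andbT.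
  by rewrite -normrN ler_norm.
have fp0 p : 0 <= fp p by rewrite /fp le_max lexx orbT.
have fn0 p : 0 <= fn p by rewrite /fn le_max lexx orbT.
have -> : bsum f = (fun K => bsum fp K - bsum fn K).
  apply/funext => K; rewrite -mulN1r -bsumZ -bsumD; apply: eq_bsum => p.
  rewrite mulN1r /fp /fn /Num.max; case: ltrP => fp1; case: ltrP => fp2; lra.
exact: (cvgB (cvg_bsum_esum fp0 fpC) (cvg_bsum_esum fn0 fnC)).
Qed.

Lemma in_l2P a : in_l2 a <-> exists C, forall K, bsum (fun p => a p ^+ 2) K <= C.
Proof. by apply: esum_finite => p; exact: sqr_ge0. Qed.

Lemma cvg_l2sq a : in_l2 a -> bsum (fun p => a p ^+ 2) K @[K --> \oo] --> l2sq a.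
Proof. by move=> /in_l2P[C aC]; apply: (cvg_bsum_esum _ aC) => p; exact: sqr_ge0. Qed.

Lemma bsum_le_l2sq a K : in_l2 a -> bsum (fun p => a p ^+ 2) K <= l2sq a.
Proof. by move=> /in_l2P[C aC]; apply: (bsum_le_esum _ _ aC) => p; exact: sqr_ge0. Qed.

Lemma l2sq_le a C : (forall K, bsum (fun p => a p ^+ 2) K <= C) -> l2sq a <= C.
Proof.
move=> aC; have al2 : in_l2 a by apply/in_l2P; exists C.
have ca := cvg_l2sq al2; rewrite -(cvg_lim (@Rhausdorff R) ca).
apply: limr_le; first by apply/cvg_ex; eexists; exact: ca.
exact: nearW.
Qed.

Lemma l2sq_ge0 a : 0 <= l2sq a.
Proof. by apply: fine_ge0; apply: esum_ge0 => p _; rewrite lee_fin sqr_ge0. Qed.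

Lemma bsum_abs_le a b K : in_l2 a -> in_l2 b ->
  bsum (fun p => `|a p * b p|) K <= l2sq a + l2sq b.
Proof.
move=> al2 bl2; apply: (@le_trans _ _ (bsum (fun p => a p ^+ 2 + b p ^+ 2) K)).
  apply: ler_bsum => p; rewrite normrM -(real_normK (num_real (a p))).
  rewrite -(real_normK (num_real (b p))).
  have := sqr_ge0 (`|a p| - `|b p|); have := normr_ge0 (a p); have := normr_ge0 (b p).
  by move=> ? ? ?; nra.
by rewrite bsumD lerD// bsum_le_l2sq.
Qed.

Lemma cvg_bsum_usumM a b : in_l2 a -> in_l2 b ->
  bsum (fun p => a p * b p) K @[K --> \oo] --> usum (fun p => a p * b p).
Proof. by move=> al2 bl2; apply: cvg_bsum_usum => K; exact: bsum_abs_le. Qed.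

Lemma usum_CauchySchwarz a b : in_l2 a -> in_l2 b ->
  usum (fun p => a p * b p) ^+ 2 <= l2sq a * l2sq b.
Proof.
move=> al2 bl2; have cab := cvg_bsum_usumM al2 bl2.
have cab2 : bsum (fun p => a p * b p) K * bsum (fun p => a p * b p) K @[K --> \oo] -->
    usum (fun p => a p * b p) * usum (fun p => a p * b p) by exact: cvgM.
rewrite expr2 -(cvg_lim (@Rhausdorff R) cab2).
apply: limr_le; first by apply/cvg_ex; eexists; exact: cab2.
apply: nearW => K; rewrite /= -expr2; apply: le_trans (bsum_CauchySchwarz _ _ _) _.
by apply: ler_pM; rewrite ?bsum_le_l2sq// bsum_ge0// => p; exact: sqr_ge0.
Qed.

Lemma in_l2_comb x a y b : in_l2 a -> in_l2 b -> in_l2 (fun p => x * a p + y * b p).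
Proof.
move=> al2 bl2; apply/in_l2P.
exists (2 * x ^+ 2 * l2sq a + 2 * y ^+ 2 * l2sq b) => K.
apply: (@le_trans _ _ (bsum (fun p => 2 * x ^+ 2 * a p ^+ 2 + 2 * y ^+ 2 * b p ^+ 2) K)).
  apply: ler_bsum => p; have := sqr_ge0 (x * a p - y * b p); nra.
by rewrite bsumD !bsumZ; apply: lerD; apply: ler_wpM2l;
  solve [exact: bsum_le_l2sq | exact: mulr_ge0 (sqr_ge0 _)].
Qed.

Lemma usum_comb x a y b c : in_l2 a -> in_l2 b -> in_l2 c ->
  usum (fun p => (x * a p + y * b p) * c p) =
  x * usum (fun p => a p * c p) + y * usum (fun p => b p * c p).
Proof.
move=> al2 bl2 cl2.
have c1 := cvg_bsum_usumM (in_l2_comb x y al2 bl2) cl2.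
have c2 : bsum (fun p => (x * a p + y * b p) * c p) K @[K --> \oo] -->
    x * usum (fun p => a p * c p) + y * usum (fun p => b p * c p).
  rewrite [X in X @ _](_ : _ = (fun K => x * bsum (fun p => a p * c p) K +
      y * bsum (fun p => b p * c p) K)); last first.
    apply/funext => K; rewrite -!bsumZ -bsumD; apply: eq_bsum => p; ring.
  by apply: cvgD; apply: cvgMl_tmp; exact: cvg_bsum_usumM.
exact: (cvg_unique (@Rhausdorff R) c1 c2).
Qed.

(** The coefficients [1] and [-1] stay explicit so that the difference is an instance of
    [in_l2_comb] and [usum_comb]. *)
Lemma l2sq_parallelogram a b : in_l2 a -> in_l2 b ->
  l2sq (fun p => 1 * a p + (-1) * b p) =
  2 * l2sq a + 2 * l2sq b - 4 * l2sq (fun p => 2^-1 * a p + 2^-1 * b p).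
Proof.
move=> al2 bl2.
have c1 := cvg_l2sq (in_l2_comb 1 (-1) al2 bl2).
have c2 := cvg_l2sq (in_l2_comb 2^-1 2^-1 al2 bl2).
have c3 : bsum (fun p => (1 * a p + (-1) * b p) ^+ 2) K @[K --> \oo] -->
    2 * l2sq a + 2 * l2sq b - 4 * l2sq (fun p => 2^-1 * a p + 2^-1 * b p).
  rewrite [X in X @ _](_ : _ = (fun K => 2 * bsum (fun p => a p ^+ 2) K +
      2 * bsum (fun p => b p ^+ 2) K -
      4 * bsum (fun p => (2^-1 * a p + 2^-1 * b p) ^+ 2) K)); last first.
    apply/funext => K; rewrite -mulNr -!bsumZ -!bsumD; by apply: eq_bsum => p; field.
  apply: cvgB; last exact: cvgMl_tmp c2.
  by apply: cvgD; apply: cvgMl_tmp; exact: cvg_l2sq.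
exact: (cvg_unique (@Rhausdorff R) c1 c3).
Qed.

Lemma cvg_bsum (u : nat -> mindex D -> R) a K :
  (forall p, u n p @[n --> \oo] --> a p) -> bsum (u n) K @[n --> \oo] --> bsum a K.
Proof.
move=> ua; rewrite /bsum; elim: (index_enum _) => [|q r IH].
  rewrite big_nil; under eq_fun do rewrite big_nil; exact: cvg_cst.
by rewrite big_cons; under eq_fun do rewrite big_cons; exact: cvgD.
Qed.

Lemma sqr_le_l2sq a p : in_l2 a -> a p ^+ 2 <= l2sq a.
Proof.
move=> al2; apply: le_trans (bsum_le_l2sq (\max_l p l) al2).
rewrite bsumE -[leLHS](big_seq1 +%R p (fun p => a p ^+ 2)).
apply: ler_sum_subseq => // [q|q]; first exact: sqr_ge0.
rewrite inE => /eqP ->; rewrite in_box; apply/forallP => l.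
exact: (leq_bigmax l).
Qed.

(** A minimising sequence in a midpoint-convex set is Cauchy by the parallelogram identity. The
    completeness of l2 is proved along the way, through coordinatewise limits. *)
Lemma l2_min_norm (C : set (mindex D -> R)) :
  C !=set0 -> (forall a, C a -> in_l2 a) ->
  (forall a b, C a -> C b -> C (fun p => 2^-1 * a p + 2^-1 * b p)) ->
  (forall a, in_l2 a -> (forall e, 0 < e ->
     exists2 a', C a' & l2sq (fun p => 1 * a' p + (-1) * a p) <= e) -> C a) ->
  exists a0, C a0 /\ forall a, C a -> l2sq a0 <= l2sq a.
Proof.
move=> [aC CaC] Cl2 Cmid Ccl.
pose E := [set l2sq a | a in C]; pose m := inf E.
have infE : has_inf E.
  split; first by exists (l2sq aC), aC.
  by exists 0 => _ [a _ <-]; exact: l2sq_ge0.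
have mE a : C a -> m <= l2sq a.
  by move=> Ca; apply: (inf_lbound infE.2); exists a.
have /choice[u uP] (n : nat) : exists a, C a /\ l2sq a < m + n.+1%:R^-1.
  have [|_ [a Ca <-] am] := @inf_adherent R E n.+1%:R^-1 _ infE; first by rewrite invr_gt0.
  by exists a.
have uC n : C (u n) by case: (uP n).
have ul2 n : in_l2 (u n) by exact: Cl2.
have dl2 n k : in_l2 (fun p => 1 * u n p + (-1) * u k p) by exact: in_l2_comb.
(* The squared norms exceed [m] by at most 1/(n+1) and 1/(k+1), and that of the midpoint is at least
   [m], which leaves 2/(n+1) + 2/(k+1). *)
have ucauchy n k : (n <= k)%N -> l2sq (fun p => 1 * u n p + (-1) * u k p) <= 4 / n.+1%:R.
  move=> nk; rewrite l2sq_parallelogram//.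
  have := mE _ (Cmid _ _ (uC n) (uC k)); have [_ un] := uP n; have [_ uk] := uP k.
  have : (k.+1%:R^-1 : R) <= n.+1%:R^-1 by rewrite lef_pV2 ?posrE// ler_nat ltnS.
  by move: un uk; set x := n.+1%:R^-1; set y := k.+1%:R^-1; lra.
have big e : 0 < e -> exists n : nat, 4 / n.+1%:R < e :> R.
  move=> e0; exists (Num.truncn (4 / e)).
  rewrite ltr_pdivrMr// mulrC -ltr_pdivrMr//.
  exact: truncnS_gt.
have ucvg p : cvgn (fun n => u n p).
  apply/cauchy_cvgP; apply/cauchy_exP => e e0.
  have [N NE] := big (e ^+ 2) (exprn_gt0 2 e0).
  exists (u N p); exists N => // n /= Nn.
  rewrite -ball_normE/= -(@ltr_pXn2r _ 2)// ?nnegrE ?normr_ge0 ?(ltW e0)//.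
  rewrite real_normK ?num_real//; apply: le_lt_trans NE.
  apply: le_trans (ucauchy _ _ Nn).
  have := sqr_le_l2sq p (dl2 N n).
  by rewrite mul1r mulN1r.
pose a p := limn (fun n => u n p).
have ua p : u n p @[n --> \oo] --> a p by exact: ucvg.
(* The limit in [k] is taken on a finite box and the bound does not depend on [K]: coordinatewise
   convergence becomes convergence in l2. *)
have dle n K : bsum (fun p => (1 * u n p + (-1) * a p) ^+ 2) K <= 4 / n.+1%:R.
  have c1 : bsum (fun p => (1 * u n p + (-1) * u k p) ^+ 2) K @[k --> \oo] -->
      bsum (fun p => (1 * u n p + (-1) * a p) ^+ 2) K.
    apply: (@cvg_bsum (fun k p => (1 * u n p + (-1) * u k p) ^+ 2)) => p.
    under eq_fun do rewrite expr2.
    rewrite expr2; have c2 : 1 * u n p + -1 * u k p @[k --> \oo] --> 1 * u n p + -1 * a p.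
      by apply: cvgD; [exact: cvg_cst|exact: cvgMl_tmp].
    exact: cvgM.
  rewrite -(cvg_lim (@Rhausdorff R) c1); apply: limr_le.
    by apply/cvg_ex; eexists; exact: c1.
  exists n => // k /= nk; apply: le_trans (ucauchy n k nk).
  exact: bsum_le_l2sq.
have al2 : in_l2 a.
  have d0 : in_l2 (fun p => 1 * u 0%N p + (-1) * a p) by apply/in_l2P; exists (4 / 1%:R); exact: dle.
  have := in_l2_comb 1 (-1) (ul2 0%N) d0; congr in_l2.
  by apply/funext => p; ring.
exists a; split.
  apply: Ccl => // e e0; have [N NE] := big e e0.
  by exists (u N) => //; apply: l2sq_le => K; apply: le_trans (dle N K) (ltW NE).
move=> b Cb; apply: le_trans (mE b Cb); apply: l2sq_le => K.
have c1 : bsum (fun p => u n p ^+ 2) K @[n --> \oo] --> bsum (fun p => a p ^+ 2) K.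
  apply: (@cvg_bsum (fun k p => u k p ^+ 2)) => p.
  under eq_fun do rewrite expr2.
  by rewrite expr2; apply: cvgM.
apply/ler_addgt0Pr => e e0.
have [N NE] := big e e0.
rewrite -(cvg_lim (@Rhausdorff R) c1); apply: limr_le.
  by apply/cvg_ex; eexists; exact: c1.
exists N => // n /= Nn; apply: le_trans (bsum_le_l2sq K (ul2 n)) _.
have [_ /ltW un] := uP n; apply: (le_trans un); rewrite lerD2l.
apply: le_trans (ltW NE).
apply: (@le_trans _ _ N.+1%:R^-1); first by rewrite lef_pV2 ?posrE// ler_nat ltnS.
by rewrite ler_peMl ?invr_ge0// ler1n.
Qed.

End box_sums.

(** * Orthonormal families in L^2 *)

Section square_integrable.
Context {R : realType} {d : measure_display} {Omega : measurableType d}.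
Variable P : probability Omega R.
Implicit Types X Y Z : Omega -> R.

Definition sqintegrable X : Prop :=
  measurable_fun setT X /\ P.-integrable setT (EFin \o (fun w => X w ^+ 2)).

Definition inner X Y : R := fine (\int[P]_w (X w * Y w)%:E)%E.

Lemma sqintegrableP X : measurable_fun setT X ->
  (\int[P]_w (X w ^+ 2)%:E < +oo)%E -> sqintegrable X.
Proof.
move=> mX fX; split=> //; apply/integrableP; split.
  by apply/measurable_EFinP; exact: measurable_funX.
under eq_integral do rewrite /= ger0_norm ?sqr_ge0//.
exact: fX.
Qed.

Let eq_integrableT X Y : X =1 Y ->
  P.-integrable setT (EFin \o X) -> P.-integrable setT (EFin \o Y).
Proof. by move=> /funext ->. Qed.

Lemma inner_expectation X Y : sqintegrable X -> sqintegrable Y ->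
  has_expectation P (fun w => X w * Y w) (inner X Y).
Proof.
move=> [mX X2] [mY Y2]; apply: integrable_has_expectation.
apply: (@dominated_integrable _ _ _ P _ (fun w => X w ^+ 2 + Y w ^+ 2)).
- exact: measurable_funM.
- exact: has_expectationD (integrable_has_expectation X2) (integrable_has_expectation Y2).
- move=> w; rewrite normrM -(real_normK (num_real (X w))) -(real_normK (num_real (Y w))).
  have := sqr_ge0 (`|X w| - `|Y w|); have := normr_ge0 (X w); have := normr_ge0 (Y w).
  by move=> ? ? ?; nra.
Qed.

Lemma has_inner X Y v : has_expectation P (fun w => X w * Y w) v -> inner X Y = v.
Proof. by move=> [_ e]; rewrite /inner e. Qed.

Lemma innerC X Y : inner X Y = inner Y X.
Proof. by congr fine; apply: eq_integral => w _; rewrite mulrC. Qed.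

Lemma sqintegrableD X Y : sqintegrable X -> sqintegrable Y ->
  sqintegrable (fun w => X w + Y w).
Proof.
move=> sX sY; have [mX _] := sX; have [mY _] := sY; split; first exact: measurable_funD.
have H := has_expectationD (has_expectationD (inner_expectation sX sX) (inner_expectation sY sY))
  (has_expectationZ 2 (inner_expectation sX sY)).
by case: H => + _; apply: eq_integrableT => w; ring.
Qed.

Lemma sqintegrableZ c X : sqintegrable X -> sqintegrable (fun w => c * X w).
Proof.
move=> sX; have [mX _] := sX; split; first exact: measurable_funM.
have H := has_expectationZ (c ^+ 2) (inner_expectation sX sX).
by case: H => + _; apply: eq_integrableT => w; ring.
Qed.

Lemma sqintegrableB X Y : sqintegrable X -> sqintegrable Y ->
  sqintegrable (fun w => X w - Y w).
Proof.
move=> sX /(sqintegrableZ (-1)) sY; have := sqintegrableD sX sY.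
by congr sqintegrable; apply/funext => w; rewrite mulN1r.
Qed.

Lemma sqintegrable_sum I (r : seq I) (c : I -> R) (X : I -> Omega -> R) :
  (forall i, sqintegrable (X i)) -> sqintegrable (fun w => \sum_(i <- r) c i * X i w).
Proof.
move=> sX; elim: r => [|i r IH].
  under eq_fun do rewrite big_nil.
  split=> //; have [i _] := @has_expectation0 _ _ _ P; move: i.
  by apply: eq_integrableT => w; rewrite expr0n.
under eq_fun do rewrite big_cons.
exact: sqintegrableD (sqintegrableZ _ (sX i)) IH.
Qed.

Lemma inner_sumr I (r : seq I) (c : I -> R) (X : I -> Omega -> R) Y :
  sqintegrable Y -> (forall i, sqintegrable (X i)) ->
  inner Y (fun w => \sum_(i <- r) c i * X i w) = \sum_(i <- r) c i * inner Y (X i).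
Proof.
move=> sY sX; apply: has_inner.
have H := has_expectation_sum r (fun i => has_expectationZ (c i) (inner_expectation sY (sX i))).
apply: eq_has_expectation H => // w; rewrite mulr_sumr; apply: eq_bigr => i _; ring.
Qed.

Lemma innerBr X Y Z : sqintegrable X -> sqintegrable Y -> sqintegrable Z ->
  inner X (fun w => Y w - Z w) = inner X Y - inner X Z.
Proof.
move=> sX sY sZ; apply: has_inner.
apply: eq_has_expectation (has_expectationB (inner_expectation sX sY) (inner_expectation sX sZ)) => // w.
by rewrite mulrBr.
Qed.

Lemma inner_ge0 X : 0 <= inner X X.
Proof.
by apply: fine_ge0; apply: integral_ge0 => w _; rewrite lee_fin -expr2 sqr_ge0.
Qed.

Lemma inner_subE X Y : sqintegrable X -> sqintegrable Y ->
  inner (fun w => X w - Y w) (fun w => X w - Y w) =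
  inner X X - 2 * inner X Y + inner Y Y.
Proof.
move=> sX sY; rewrite innerBr//; last exact: sqintegrableB.
by rewrite ![inner (fun w => _ - _) _]innerC !innerBr// (innerC Y X); ring.
Qed.

Lemma inner_CauchySchwarz X Y : sqintegrable X -> sqintegrable Y ->
  inner X Y ^+ 2 <= inner X X * inner Y Y.
Proof.
move=> sX sY; apply: discriminant_le => [|t]; first exact: inner_ge0.
have H := has_expectationD (has_expectationD (inner_expectation sX sX)
  (has_expectationZ (2 * t) (inner_expectation sX sY)))
  (has_expectationZ (t ^+ 2) (inner_expectation sY sY)).
apply: has_expectation_ge0 H => w.
have -> : X w * X w + 2 * t * (X w * Y w) + t ^+ 2 * (Y w * Y w) = (X w + t * Y w) ^+ 2 by ring.
exact: sqr_ge0.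
Qed.

Lemma sqintegrable1 : sqintegrable (fun=> 1).
Proof.
split=> //; have : P.-integrable [set: Omega] (EFin \o fun=> (1 : R)).
  by apply: finite_measure_integrable_cst.
by apply: eq_integrableT => w; rewrite expr1n.
Qed.

Variables (D : nat) (e : mindex D -> Omega -> R).
Hypothesis se : forall p, sqintegrable (e p).
Hypothesis orth : forall p q, inner (e p) (e q) = (p == q)%:R.

Definition box_comb (a : mindex D -> R) (K : nat) (w : Omega) : R :=
  bsum (fun p => a p * e p w) K.

Lemma sqintegrable_box_comb a K : sqintegrable (box_comb a K).
Proof.
exact: (@sqintegrable_sum _ _ (fun q : {ffun 'I_D -> 'I_K.+1} => a [ffun l => val (q l)])
  (fun q => e [ffun l => val (q l)]) (fun q => se _)).
Qed.

Lemma inner_box_comb X a K : sqintegrable X ->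
  inner X (box_comb a K) = bsum (fun p => a p * inner X (e p)) K.
Proof.
move=> sX; exact: (@inner_sumr _ _ (fun q : {ffun 'I_D -> 'I_K.+1} => a [ffun l => val (q l)])
  (fun q => e [ffun l => val (q l)]) X sX (fun q => se _)).
Qed.

Lemma inner_box_comb_base a K (p : mindex D) : (forall l, (p l <= K)%N) ->
  inner (box_comb a K) (e p) = a p.
Proof.
move=> pK; rewrite innerC inner_box_comb// (@bsum_single _ _ _ _ p)//.
  by rewrite orth eqxx mulr1.
by move=> q qp; rewrite orth eq_sym (negbTE qp) mulr0.
Qed.

Lemma inner_box_comb2 a K K' : (K <= K')%N ->
  inner (box_comb a K') (box_comb a K) = bsum (fun p => a p ^+ 2) K.
Proof.
move=> KK'; rewrite inner_box_comb; last exact: sqintegrable_box_comb.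
apply: eq_bigr => q _; rewrite inner_box_comb_base ?expr2// => l.
by rewrite ffunE (leq_trans _ KK')// -ltnS ltn_ord.
Qed.

Lemma dist_box_comb X K : sqintegrable X ->
  let a p := inner X (e p) in
  inner (fun w => X w - box_comb a K w) (fun w => X w - box_comb a K w) =
  inner X X - bsum (fun p => a p ^+ 2) K.
Proof.
move=> sX a; rewrite inner_subE//; last exact: sqintegrable_box_comb.
rewrite inner_box_comb2// inner_box_comb//.
rewrite (@eq_bsum _ _ (fun p => a p * inner X (e p)) (fun p => a p ^+ 2)); last first.
  by move=> p; rewrite expr2.
ring.
Qed.

Lemma bessel X K : sqintegrable X ->
  bsum (fun p => inner X (e p) ^+ 2) K <= inner X X.
Proof. by move=> sX; rewrite -subr_ge0 -dist_box_comb// inner_ge0. Qed.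

Lemma bessel_l2 X : sqintegrable X -> in_l2 (fun p => inner X (e p)).
Proof. by move=> sX; apply/in_l2P; exists (inner X X) => K; exact: bessel. Qed.

(** Equality in Bessel's inequality for [L] means that its partial sums converge to it in mean
    square. Cauchy-Schwarz carries this to the pairing with any [X], even outside the closed
    span. *)
Lemma parseval X L : sqintegrable X -> sqintegrable L ->
  bsum (fun p => inner L (e p) ^+ 2) K @[K --> \oo] --> inner L L ->
  usum (fun p => inner X (e p) * inner L (e p)) = inner X L.
Proof.
move=> sX sL cL.
have c1 := cvg_bsum_usumM (bessel_l2 sX) (bessel_l2 sL).
apply: (cvg_unique (@Rhausdorff R) c1).
have c2 : inner X X * (inner L L - bsum (fun p => inner L (e p) ^+ 2) K) @[K --> \oo] --> 0.
  rewrite -(mulr0 (inner X X)) -(subrr (inner L L)).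
  by apply: cvgMl_tmp; apply: cvgB => //; exact: cvg_cst.
apply/cvgrPdist_lt => r r0.
have r20 : 0 < r ^+ 2 by exact: exprn_gt0.
move/cvgrPdist_lt: c2 => /(_ _ r20)[N _ HN]; exists N => // K /= NK.
have := HN K NK; rewrite /= sub0r normrN => HK.
rewrite -(@ltr_pXn2r _ 2)// ?nnegrE ?normr_ge0 ?(ltW r0)// real_normK ?num_real//.
apply: le_lt_trans HK; apply: le_trans (ler_norm _).
rewrite -dist_box_comb//.
have sB := sqintegrable_box_comb (fun p => inner L (e p)) K.
rewrite (_ : inner X L - _ = inner X (fun w => L w - box_comb (fun p => inner L (e p)) K w)).
  by apply: inner_CauchySchwarz => //; exact: sqintegrableB.
rewrite innerBr// inner_box_comb//; congr (_ - _).
by apply: eq_bsum => p; rewrite mulrC.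
Qed.

(** Inner products are continuous in mean square, so coefficients and norms survive the limit. *)
Lemma L2_limit a Y : measurable_fun setT Y ->
  (\int[P]_w ((box_comb a K w - Y w) ^+ 2)%:E)%E @[K --> \oo] --> 0%E ->
  [/\ sqintegrable Y, forall p, inner Y (e p) = a p & inner Y Y = l2sq a].
Proof.
move=> mY cY.
have sS K := sqintegrable_box_comb a K.
(* Convergence to 0 makes the integrals finite from some [N] on; [Y] then differs from the partial
   sum at [N] by a square integrable function. *)
have /fine_cvgP[[N _ finN] cd] := cY.
have sY : sqintegrable Y.
  have sSY : sqintegrable (fun w => box_comb a N w - Y w).
    apply: sqintegrableP; first by apply: measurable_funB => //; have [] := sS N.
    by have := finN N (leqnn N); rewrite fin_numE => /andP[_]; rewrite ltey.
  have := sqintegrableB (sS N) sSY; congr sqintegrable; apply/funext => w; ring.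
pose delta K := inner (fun w => box_comb a K w - Y w) (fun w => box_comb a K w - Y w).
have {}cd : delta K @[K --> \oo] --> 0 by exact: cd.
have Ye p : inner Y (e p) = a p.
  apply/eqP; rewrite -subr_eq0 -sqrf_eq0 eq_le sqr_ge0 andbT.
  rewrite -(cvg_lim (@Rhausdorff R) cd); apply: limr_ge.
    by apply/cvg_ex; eexists; exact: cd.
  (* From this size on, [p] lies in the box and the partial sum has coefficient exactly [a p]. *)
  exists (\max_l p l) => // K /= pK.
  have -> : (inner Y (e p) - a p) ^+ 2 = inner (e p) (fun w => box_comb a K w - Y w) ^+ 2.
    rewrite innerBr// [inner (e p) (box_comb _ _)]innerC inner_box_comb_base ?(innerC _ Y).
      ring.
    by move=> l; apply: leq_trans pK; exact: (leq_bigmax l).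
  apply: le_trans (inner_CauchySchwarz (se p) (sqintegrableB (sS K) sY)) _.
  by rewrite orth eqxx mul1r.
split=> //.
have al2 : in_l2 a.
  by have := bessel_l2 sY; congr in_l2; apply/funext => p.
have c1 := cvg_l2sq al2; apply/esym; apply: (cvg_unique (@Rhausdorff R) c1).
have -> : bsum (fun p => a p ^+ 2) = (fun K => inner Y Y - delta K).
  apply/funext => K; rewrite /delta inner_subE// [inner (box_comb _ _) Y]innerC.
  rewrite inner_box_comb2// inner_box_comb//.
  rewrite (@eq_bsum _ _ (fun p => a p * inner Y (e p)) (fun p => a p ^+ 2)).
    ring.
  by move=> p; rewrite Ye expr2.
have c2 : inner Y Y - delta K @[K --> \oo] --> inner Y Y - 0.
  by apply: cvgB => //; exact: cvg_cst.
by rewrite subr0 in c2.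
Qed.

End square_integrable.

(** * Riesz-Fischer theorem for functions of an observation *)

Section riesz_fischer.
Context {R : realType} {d d' : measure_display} {Omega : measurableType d}
  {T : measurableType d'}.
Variables (P : probability Omega R) (phi : Omega -> T) (D : nat) (E : mindex D -> T -> R).
Hypotheses (mphi : measurable_fun setT phi) (mE : forall p, measurable_fun setT (E p)).
Let e p w := E p (phi w).
Hypothesis se : forall p, sqintegrable P (e p).
Hypothesis orth : forall p q, inner P (e p) (e q) = (p == q)%:R.

(** The limit must be a function of [phi w], not of the sample point, so it is built on [T] from a
    rapidly convergent subsequence of partial sums. *)
Lemma riesz_fischer a : in_l2 a -> exists G : T -> R, measurable_fun setT G /\
  (\int[P]_w ((box_comb e a K w - G (phi w)) ^+ 2)%:E)%E @[K --> \oo] --> 0%E.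
Proof.
move=> al2.
pose S K t := bsum (fun p => a p * E p t) K.
have mS K : measurable_fun setT (S K).
  by apply: measurable_sum => q; exact: measurable_funM.
have sS K : sqintegrable P (fun w => S K (phi w)) by exact: (sqintegrable_box_comb se).
pose tail K := l2sq a - bsum (fun p => a p ^+ 2) K.
have tail_cvg : tail K @[K --> \oo] --> 0.
  rewrite -(subrr (l2sq a)); apply: cvgB; [exact: cvg_cst|exact: cvg_l2sq].
pose dist2 K K' := inner P (fun w => S K (phi w) - S K' (phi w))
  (fun w => S K (phi w) - S K' (phi w)).
have dist2_le K K' : (K <= K')%N -> dist2 K' K <= tail K.
  move=> KK'; rewrite /dist2 inner_subE//.
  have -> := inner_box_comb2 se orth a KK'.
  have -> := inner_box_comb2 se orth a (leqnn K).
  have -> := inner_box_comb2 se orth a (leqnn K').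
  by have := bsum_le_l2sq K' al2; rewrite /tail; lra.
have dist2C K K' : dist2 K K' = dist2 K' K.
  by congr fine; apply: eq_integral => w _; congr EFin; ring.
have dist2_int K K' : (\int[P]_w ((S K (phi w) - S K' (phi w)) ^+ 2)%:E)%E = (dist2 K K')%:E.
  have [_ <-] := inner_expectation (sqintegrableB (sS K) (sS K')) (sqintegrableB (sS K) (sS K')).
  by apply: eq_integral => w _; rewrite expr2.
(* This is 2^(-j), in the shape of the geometric series lemma; it will bound the L^1 distance
   between consecutive terms. *)
pose c (j : nat) : R := 2 / (2 ^ (j + 1))%:R.
have c0 j : 0 < c j by rewrite divr_gt0// ltr0n expn_gt0.
have /choice[k0 k0P] (j : nat) : exists N, forall K, (N <= K)%N -> tail K <= c j ^+ 2.
  move/cvgrPdist_lt: tail_cvg => /(_ _ (exprn_gt0 2 (c0 j)))[N _ HN].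
  exists N => K NK; have := HN K NK; rewrite /= sub0r normrN => /ltW.
  exact: le_trans (ler_norm _).
(* The maximum sends [k j] to infinity, as the Fatou argument requires. [k] may fail to be monotone,
   hence the two cases in [dX]. *)
pose k j := maxn (k0 j) j.
have kP j : tail (k j) <= c j ^+ 2 by apply: k0P; exact: leq_maxl.
have c_anti j : c j.+1 <= c j.
  by rewrite /c ler_wpM2l// lef_pV2 ?posrE ?ltr0n ?expn_gt0// ler_nat leq_exp2l// addSn.
pose X j w := S (k j) (phi w).
have mX j : measurable_fun setT (X j) by exact: measurableT_comp.
have dX j : dist2 (k j.+1) (k j) <= c j ^+ 2.
  have [kk|/ltnW kk] := leqP (k j) (k j.+1); first exact: le_trans (dist2_le _ _ kk) (kP j).
  rewrite dist2C; apply: le_trans (dist2_le _ _ kk) _; apply: le_trans (kP j.+1) _.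
  by apply: lerXn2r; rewrite ?nnegrE ?(ltW (c0 _)).
pose Del j w := `|X j.+1 w - X j w|.
have Del0 j w : 0 <= Del j w by exact: normr_ge0.
have mDel j : measurable_fun setT (Del j).
  by apply: measurableT_comp => //; exact: measurable_funB.
(* Cauchy-Schwarz against the constant 1 bounds the L^1 norm by the L^2 norm, as [P] has mass 1. *)
have intDel j : (\int[P]_w (Del j w)%:E <= (c j)%:E)%E.
  have sD : sqintegrable P (Del j).
    split=> //; have [_] := sqintegrableB (sS (k j.+1)) (sS (k j)).
    have -> // : (fun w => Del j w ^+ 2) = (fun w => (S (k j.+1) (phi w) - S (k j) (phi w)) ^+ 2).
    by apply/funext => w; rewrite /Del real_normK ?num_real.
  have [_ H] := inner_expectation sD (sqintegrable1 P).
  have -> : (\int[P]_w (Del j w)%:E)%E = (inner P (Del j) (fun=> 1))%:E.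
    by rewrite -H; apply: eq_integral => w _; rewrite mulr1.
  rewrite lee_fin; have CS := inner_CauchySchwarz sD (sqintegrable1 P).
  have i1 : inner P (fun=> 1) (fun=> 1) = 1.
    rewrite /inner; have := expectation_cst P 1; rewrite unlock => e1.
    by rewrite (_ : (\int[P]_w _)%E = 1%:E)// -e1; apply: eq_integral => w _; rewrite mulr1.
  have iD : inner P (Del j) (Del j) = dist2 (k j.+1) (k j).
    by congr fine; apply: eq_integral => w _; rewrite -!expr2 /Del real_normK ?num_real.
  rewrite i1 mulr1 iD in CS.
  have := le_trans CS (dX j); rewrite ler_sqr// ?nnegrE ?(ltW (c0 _))//.
  apply: fine_ge0; apply: integral_ge0 => w _; rewrite mulr1 lee_fin; exact: normr_ge0.
(* Total variation of the subsequence at [w]. Being integrable, it is finite almost everywhere, and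
   there the telescoping series converges absolutely. *)
pose F w := (\sum_(j <oo) (Del j w)%:E)%E.
have mF : measurable_fun setT F.
  apply: ge0_emeasurable_sum => [j w _ _|j _]; first by rewrite lee_fin Del0.
  exact/measurable_EFinP.
have F0 w : (0 <= F w)%E by apply: nneseries_ge0 => j _ _; rewrite lee_fin Del0.
have iF : P.-integrable setT F.
  apply/integrableP; split=> //.
  under eq_integral do rewrite gee0_abs//.
  rewrite integral_nneseries//; last 2 first.
  - by move=> j; exact/measurable_EFinP.
  - by move=> j w _; rewrite lee_fin Del0.
  apply: (@le_lt_trans _ _ (\sum_(j <oo) (c j)%:E)%E).
    apply: lee_nneseries => [j _ _|j _]; last exact: intDel.
    by apply: integral_ge0 => w _; rewrite lee_fin Del0.
  have cc := @cvg_geometric_eseries_half R 2 0.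
  rewrite (_ : (\sum_(j <oo) (c j)%:E)%E = (2 / 2 ^+ 0)%:E) ?ltry//.
  by apply/cvg_lim => //; exact: cc.
(* The upper limit is measurable on all of [T], including points where the subsequence diverges. *)
pose G t := fine (limn_esup (fun j => (S (k j) t)%:E)).
have mG : measurable_fun setT G.
  apply: (measurableT_comp (fine_measurable measurableT)).
  apply: (@measurable_fun_limn_esup _ _ _ _ (fun j t => (S (k j) t)%:E)) => j.
  exact/measurable_EFinP.
have aeX : {ae P, forall w, X j w @[j --> \oo] --> G (phi w)}.
  apply: filterS (integrable_ae measurableT iF) => w /(_ I) finw.
  have cX : cvgn (fun j => X j w).
    have cs : cvgn (series (telescope (fun j => X j w))).
      apply: normed_cvg; apply: nondecreasing_is_cvgn.
        by apply: nondecreasing_series => j _ _; exact: normr_ge0.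
      exists (fine (F w)) => _ [n _ <-] /=.
      rewrite -lee_fin fineK// -sumEFin.
      by apply: (nneseries_lim_ge n) => j _ _; rewrite lee_fin Del0.
    have -> : (fun j => X j w) = (fun j => X 0%N w + series (telescope (fun j => X j w)) j).
      by apply/funext => j; rewrite telescopeK /= addrC addrNK.
    by apply: is_cvgD => //; exact: is_cvg_cst.
  have /cvg_ex[l Xl] := cX.
  suff <- : l = G (phi w) by [].
  have Xl' : (X j w)%:E @[j --> \oo] --> l%:E by apply: cvg_EFin => //; exact: nearW.
  by rewrite /G; have [_ ->] := cvg_limn_einf_sup Xl'.
exists G; split=> //.
have mGphi : measurable_fun setT (fun w => G (phi w)) by exact: measurableT_comp.
(* Fatou's lemma along the subsequence: the squared distance from [S K] to [X j] is at most [tail K]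
   as soon as [K <= k j]. *)
have main K : (\int[P]_w ((S K (phi w) - G (phi w)) ^+ 2)%:E <= (tail K)%:E)%E.
  pose f j w := ((S K (phi w) - X j w) ^+ 2)%:E.
  have mf j : measurable_fun setT (f j).
    apply/measurable_EFinP; apply: measurable_funX; apply: measurable_funB => //.
    exact: measurableT_comp.
  have f0 j w : (0 <= f j w)%E by rewrite lee_fin sqr_ge0.
  have -> : (\int[P]_w ((S K (phi w) - G (phi w)) ^+ 2)%:E = \int[P]_w limn_einf (f^~ w))%E.
    apply: ge0_ae_eq_integral => //.
    - apply/measurable_EFinP; apply: measurable_funX; apply: measurable_funB => //.
      exact: measurableT_comp.
    - apply: measurableT_comp => //.
      apply: (@measurable_fun_limn_esup _ _ _ _ (fun j w => - f j w)%E) => j.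
      exact: measurableT_comp.
    - by move=> w _; rewrite lee_fin sqr_ge0.
    - move=> w _; rewrite limn_einf_lim; apply: lime_ge; first exact: is_cvg_einfs.
      by apply: nearW => n; apply: le_ereal_inf_tmp => _ [m _ <-]; exact: f0.
    - apply: filterS aeX => w Xw _.
      have fc : f j w @[j --> \oo] --> ((S K (phi w) - G (phi w)) ^+ 2)%:E.
        apply: cvg_EFin; first exact: nearW.
        have cB : S K (phi w) - X j w @[j --> \oo] --> S K (phi w) - G (phi w).
          by apply: cvgB => //; exact: cvg_cst.
        have cM : (S K (phi w) - X j w) * (S K (phi w) - X j w) @[j --> \oo] -->
            (S K (phi w) - G (phi w)) * (S K (phi w) - G (phi w)) by exact: cvgM.
        exact: cM.
      by have [-> _] := cvg_limn_einf_sup fc.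
  apply: (le_trans (fatou P measurableT mf (fun j w _ => f0 j w))).
  rewrite limn_einf_lim; apply: lime_le; first exact: is_cvg_einfs.
  apply: nearW => n; pose m := maxn n K.
  apply: (@le_trans _ _ (\int[P]_w f m w)%E).
    by apply: ereal_inf_lbound; exists m => //=; exact: leq_maxl.
  rewrite [leLHS](dist2_int K (k m)) lee_fin dist2C; apply: dist2_le.
  exact: leq_trans (leq_maxr n K) (leq_maxr _ _).
apply: (@squeeze_cvge _ _ _ _ (fun=> 0%E) _ (fun K => (tail K)%:E)).
- apply: nearW => K; rewrite main andbT.
  by apply: integral_ge0 => w _; rewrite lee_fin sqr_ge0.
- exact: cvg_cst.
- by apply: cvg_EFin => //; exact: nearW.
Qed.

End riesz_fischer.

(** * Dot products and the thin SVD *)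

Section dot_product.
Context {R : realType}.

Definition dot n (u v : 'cV[R]_n) : R := \sum_i u i 0 * v i 0.

Lemma dotE n (u v : 'cV[R]_n) : dot u v = (u^T *m v) 0 0.
Proof. by rewrite mxE; apply: eq_bigr => i _; rewrite mxE. Qed.

Lemma dotC n (u v : 'cV[R]_n) : dot u v = dot v u.
Proof. by apply: eq_bigr => i _; rewrite mulrC. Qed.

Lemma dotDr n (u v w : 'cV[R]_n) : dot u (v + w) = dot u v + dot u w.
Proof. by rewrite /dot -big_split; apply: eq_bigr => i _; rewrite mxE mulrDr. Qed.

Lemma dotZr n a (u v : 'cV[R]_n) : dot u (a *: v) = a * dot u v.
Proof. by rewrite /dot mulr_sumr; apply: eq_bigr => i _; rewrite mxE mulrCA. Qed.

Lemma dotNr n (u v : 'cV[R]_n) : dot u (- v) = - dot u v.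
Proof. by rewrite -scaleN1r dotZr mulN1r. Qed.

Lemma dotDl n (u v w : 'cV[R]_n) : dot (u + v) w = dot u w + dot v w.
Proof. by rewrite ![dot _ w]dotC dotDr. Qed.

Lemma dotZl n a (u v : 'cV[R]_n) : dot (a *: u) v = a * dot u v.
Proof. by rewrite ![dot _ v]dotC dotZr. Qed.

Lemma dotNl n (u v : 'cV[R]_n) : dot (- u) v = - dot u v.
Proof. by rewrite ![dot _ v]dotC dotNr. Qed.

Lemma dot_mulmx m n (A : 'M[R]_(m, n)) u v : dot (A *m u) v = dot u (A^T *m v).
Proof. by rewrite !dotE trmx_mul mulmxA. Qed.

Lemma sqnormE n (u : 'cV[R]_n) : sqnorm u = dot u u.
Proof. by apply: eq_bigr => i _; rewrite expr2. Qed.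

End dot_product.

Definition dot_simp {R : realType} :=
  (@dotDr R, @dotDl R, @dotNr R, @dotNl R, @dotZr R, @dotZl R).

Section thin_svd_algebra.
Context {R : realType} (M N D : nat) (H : 'M[R]_(M, N)) (U : 'M[R]_(M, D))
  (s : 'rV[R]_D) (V : 'M[R]_(N, D)) (Htp : 'M[R]_(D, N)).
Hypothesis svd : thin_svd H U s V.
Let Ht : 'M[R]_(N, D) := V *m invmx (diag_mx s).
Hypothesis pinv : is_pinv Ht Htp.

Let UU : U^T *m U = 1%:M. Proof. by case: svd. Qed.
Let VV : V^T *m V = 1%:M. Proof. by case: svd. Qed.
Let HE : H = U *m diag_mx s *m V^T. Proof. by case: svd. Qed.
Let su : diag_mx s \in unitmx.
Proof.
rewrite unitmxE det_diag unitfE; apply/prodf_neq0 => i _.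
by case: svd => _ _ s0 _; rewrite gt_eqF.
Qed.

Lemma svd_mulmx_Ht : H *m Ht = U.
Proof. by rewrite HE /Ht -!mulmxA (mulmxA V^T) VV mul1mx mulmxV// mulmx1. Qed.

Lemma svd_proj : U *m (U^T *m H) = H.
Proof. by rewrite {1}HE -!mulmxA (mulmxA U^T) UU mul1mx HE -!mulmxA. Qed.

(** [U^T *m H] is diag(s) V^T, a left inverse of [Ht]. The Penrose equations make [Htp] a left
    inverse too and give it the form C V^T, and these two facts determine C. *)
Lemma svd_pinvE : Htp = U^T *m H.
Proof.
have -> : U^T *m H = diag_mx s *m V^T by rewrite HE -!mulmxA (mulmxA U^T) UU mul1mx.
have [p1 p2 p3 _] := pinv.
have VHt : diag_mx s *m V^T *m Ht = 1%:M.
  by rewrite /Ht -!mulmxA (mulmxA V^T) VV mul1mx mulmxV.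
have HtpHt : Htp *m Ht = 1%:M.
  have := congr1 (mulmx (diag_mx s *m V^T)) p1.
  by rewrite -(mulmxA Ht Htp Ht) (mulmxA _ Ht (Htp *m Ht)) VHt mul1mx.
pose C := Htp *m Htp^T *m (invmx (diag_mx s))^T.
have HtpC : Htp = C *m V^T.
  by rewrite -{1}p2 -mulmxA -p3 trmx_mul /C /Ht trmx_mul !mulmxA.
have : C *m invmx (diag_mx s) = 1%:M.
  by rewrite -HtpHt HtpC /Ht -!mulmxA (mulmxA V^T) VV mul1mx.
by move=> /(congr1 (mulmx^~ (diag_mx s))); rewrite mulmxKV// mul1mx HtpC => ->.
Qed.

End thin_svd_algebra.

(** * Gaussian projections and basis functions *)

Section gaussian_model.
Context {R : realType} {d : measure_display} {Omega : measurableType d}.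
Variables (P : probability Omega R) (M D : nat) (noise : Omega -> M.-tuple R).
Variables (sigma : R) (U : 'M[R]_(M, D)) (m0 : 'cV[R]_M).
Hypotheses (sigma0 : 0 < sigma) (Hnoise : gauss_noise P noise sigma).
Hypothesis UU : U^T *m U = 1%:M.

Let sN0 : sigma != 0. Proof. by rewrite gt_eqF. Qed.
Let mnoise : measurable_fun setT noise. Proof. by case: Hnoise. Qed.
Let n w := tcol (noise w).

Lemma cmdens_dot (h : 'cV[R]_M) (t : M.-tuple R) :
  cmdens sigma h t = expR (dot h (tcol t) / sigma ^+ 2 - dot h h / (2 * sigma ^+ 2)).
Proof.
rewrite /cmdens sqnormE.
have -> : dot h (tcol t) = \sum_i h i 0 * tnth t i; last by [].
by apply: eq_bigr => i _; rewrite mxE.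
Qed.

Lemma measurable_dot_tcol (v : 'cV[R]_M) :
  measurable_fun setT (fun t : M.-tuple R => dot v (tcol t)).
Proof.
under eq_fun do rewrite /dot.
apply: measurable_sum => i; under eq_fun do rewrite mxE.
by apply: measurable_funM => //; exact: measurable_tnth.
Qed.

(** Signed version, by positive and negative parts; as an equivalence it transfers integrability
    both ways. *)
Lemma cameron_martin_expectation h (G : M.-tuple R -> R) v : measurable_fun setT G ->
  has_expectation P (fun w => G (tshift h (noise w))) v <->
  has_expectation P (fun w => cmdens sigma h (noise w) * G (noise w)) v.
Proof.
move=> mG.
pose Gp t := Num.max (G t) 0; pose Gn t := Num.max (- G t) 0.
have mGp : measurable_fun setT Gp by apply: measurable_maxr.
have mGn : measurable_fun setT Gn by apply: measurable_maxr => //; exact: measurableT_comp.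
have Gp0 t : 0 <= Gp t by rewrite /Gp le_max lexx orbT.
have Gn0 t : 0 <= Gn t by rewrite /Gn le_max lexx orbT.
have GE t : G t = Gp t - Gn t.
  by rewrite /Gp /Gn /Num.max; case: ltrP => ?; case: ltrP => ?; lra.
have GpG t : `|Gp t| <= `|G t| by rewrite ger0_norm// /Gp ge_max normr_ge0 ler_norm.
have GnG t : `|Gn t| <= `|G t| by rewrite ger0_norm// /Gn ge_max normr_ge0 -normrN ler_norm.
pose c w := cmdens sigma h (noise w).
have c0 w : 0 <= c w by exact: expR_ge0.
have mc : measurable_fun setT c.
  exact: (measurableT_comp (measurable_cmdens sigma h) mnoise).
have mt : measurable_fun setT (fun w => tshift h (noise w)).
  exact: (measurableT_comp (measurable_tshift h) mnoise).
have mcG (F : M.-tuple R -> R) : measurable_fun setT F ->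
    measurable_fun setT (fun w => c w * F (noise w)).
  by move=> mF; apply: measurable_funM => //; exact: measurableT_comp.
have mtG (F : M.-tuple R -> R) : measurable_fun setT F ->
    measurable_fun setT (fun w => F (tshift h (noise w))).
  by move=> mF; exact: measurableT_comp.
have dom (f g : Omega -> R) u : measurable_fun setT f -> has_expectation P g u ->
    (forall w, `|f w| <= `|g w|) -> exists v, has_expectation P f v.
  move=> mf [gi _] fg; eexists; apply: integrable_has_expectation.
  have gn := integrable_has_expectation (integrable_norm gi).
  exact: (dominated_integrable mf gn).
split=> Gv.
  have [vp Hp] := dom _ _ _ (mtG _ mGp) Gv (fun w => GpG _).
  have [vn Hn] := dom _ _ _ (mtG _ mGn) Gv (fun w => GnG _).
  have Hp' : has_expectation P (fun w => c w * Gp (noise w)) vp.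
    apply: ge0_has_expectation => [|w|]; [exact: mcG|exact: mulr_ge0|].
    by rewrite -cameron_martin//; exact: Hp.2.
  have Hn' : has_expectation P (fun w => c w * Gn (noise w)) vn.
    apply: ge0_has_expectation => [|w|]; [exact: mcG|exact: mulr_ge0|].
    by rewrite -cameron_martin//; exact: Hn.2.
  apply: eq_has_expectation (has_expectationB Hp' Hn') => [w|].
    by rewrite -mulrBr -GE.
  apply: has_expectation_unique (has_expectationB Hp Hn) _.
  by apply: eq_has_expectation Gv => // w; exact: GE.
have cle (F : M.-tuple R -> R) w : `|F (noise w)| <= `|G (noise w)| ->
    `|c w * F (noise w)| <= `|c w * G (noise w)|.
  by move=> FG; rewrite !normrM ler_wpM2l.
have [vp Hp] := dom _ _ _ (mcG _ mGp) Gv (fun w => cle _ w (GpG _)).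
have [vn Hn] := dom _ _ _ (mcG _ mGn) Gv (fun w => cle _ w (GnG _)).
have Hp' : has_expectation P (fun w => Gp (tshift h (noise w))) vp.
  apply: ge0_has_expectation => //; first exact: mtG.
  by rewrite (cameron_martin sigma0 Hnoise)//; exact: Hp.2.
have Hn' : has_expectation P (fun w => Gn (tshift h (noise w))) vn.
  apply: ge0_has_expectation => //; first exact: mtG.
  by rewrite (cameron_martin sigma0 Hnoise)//; exact: Hn.2.
apply: eq_has_expectation (has_expectationB Hp' Hn') => [w|].
  by rewrite -GE.
apply: has_expectation_unique (has_expectationB Hp Hn) _.
by apply: eq_has_expectation Gv => // w; rewrite -mulrBr -GE.
Qed.

(** On the noise these coordinates are jointly standard Gaussian, because [U] has orthonormal
    columns. *)
Definition gproj (l : 'I_D) (y : 'cV[R]_M) : R := (U^T *m y) l 0 / sigma.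

Lemma gprojE l y : gproj l y = dot (sigma^-1 *: (U *m delta_mx l 0)) y.
Proof.
rewrite dotZl dot_mulmx /gproj mulrC; congr (_ * _).
rewrite /dot (bigD1 l)//= big1 ?addr0 => [|i il]; rewrite !mxE ?eqxx ?mul1r//.
by rewrite (negbTE il) mul0r.
Qed.

Lemma measurable_gproj l (v : 'cV[R]_M) :
  measurable_fun setT (fun t : M.-tuple R => gproj l (tcol t + v)).
Proof.
under eq_fun do rewrite gprojE dotDr.
by apply: measurable_funD => //; exact: measurable_dot_tcol.
Qed.

Lemma gauss_projection_expectation (q : 'I_D -> {poly R}) (t : 'I_D -> R) :
  has_expectation P (fun w => \prod_l ((q l).[gproj l (n w)] * expR (t l * gproj l (n w))))
    (\prod_l gauss_functional (t l) (q l)).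
Proof.
apply: (@gauss_poly_expectation _ _ _ P D (fun l w => gproj l (n w))) => [l|{q}{}t].
  under eq_fun do rewrite gprojE.
  exact: (measurableT_comp (measurable_dot_tcol _) mnoise).
pose tv : 'cV[R]_D := \col_l t l.
(* For this translation, the normalisation of [cmdens] reads as the moment generating function of
   the projections. *)
pose h := sigma *: (U *m tv).
have hn w : dot h (n w) / sigma ^+ 2 = \sum_l t l * gproj l (n w).
  rewrite dotZl dot_mulmx /dot mulr_sumr mulr_suml; apply: eq_bigr => l _.
  by rewrite [tv _ _]mxE /gproj; field.
have hh : dot h h / (2 * sigma ^+ 2) = \sum_l t l ^+ 2 / 2.
  rewrite dotZl dotZr dot_mulmx mulmxA UU mul1mx /dot !mulr_sumr mulr_suml.
  by apply: eq_bigr => l _; rewrite mxE; field.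
rewrite -[RHS]mule1 -(integral_cmdens sigma0 Hnoise h) -ge0_integralZl//=; first last.
- by move=> w _; rewrite lee_fin expR_ge0.
- apply/measurable_EFinP.
  exact: (measurableT_comp (measurable_cmdens sigma h) mnoise).
apply: eq_integral => w _; rewrite -EFinM; congr EFin.
by rewrite cmdens_dot -/(n w) hn hh -expRD addrC subrK.
Qed.

(** The function e_p of the observation. Its exponential is rho at z = 0 times exp (- |m0|^2 / (2
    sigma^2)). *)
Definition hbasis (p : mindex D) (y : 'cV[R]_M) : R :=
  expR (- dot y m0 / sigma ^+ 2) *
  (\prod_l (hermite (p l)).[gproj l (y + m0)]) / Num.sqrt (mfact R p).

Lemma measurable_hbasis p : measurable_fun setT (fun t : M.-tuple R => hbasis p (tcol t)).
Proof.
apply: measurable_funM => //; apply: measurable_funM.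
  apply: measurableT_comp => //; apply: measurable_funM => //.
  apply: measurableT_comp => //; under eq_fun do rewrite dotC.
  exact: measurable_dot_tcol.
apply: measurable_prod => l _.
have mh : measurable_fun setT (fun x : R => (hermite (p l)).[x]).
  apply: continuous_measurable_fun => x; exact: continuous_horner.
exact: (measurableT_comp mh (measurable_gproj l m0)).
Qed.

End gaussian_model.

(** * Likelihood ratio and its expansion *)

Lemma cvg_prod_ord (R : realType) D (u : 'I_D -> nat -> R) (v : 'I_D -> R) :
  (forall l, u l n @[n --> \oo] --> v l) ->
  \prod_l u l n @[n --> \oo] --> \prod_l v l.
Proof.
move=> uv; elim: (index_enum _) => [|l r IH].
  rewrite big_nil; under eq_fun do rewrite big_nil; exact: cvg_cst.
by rewrite big_cons; under eq_fun do rewrite big_cons; exact: cvgM.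
Qed.

Section likelihood.
Context {R : realType} {d : measure_display} {Omega : measurableType d}.
Variables (P : probability Omega R) (M N D : nat) (noise : Omega -> M.-tuple R).
Variables (H : 'M[R]_(M, N)) (sigma : R) (U : 'M[R]_(M, D)) (x0 : 'cV[R]_N).
Hypotheses (sigma0 : 0 < sigma) (Hnoise : gauss_noise P noise sigma).
Hypotheses (UU : U^T *m U = 1%:M) (UH : U *m (U^T *m H) = H).

Let sN0 : sigma != 0. Proof. by rewrite gt_eqF. Qed.
Let mnoise : measurable_fun setT noise. Proof. by case: Hnoise. Qed.
Let m0 := H *m x0.
Let n w := tcol (noise w).
Local Notation gp := (gproj sigma U).

Definition obasis (p : mindex D) (w : Omega) : R := hbasis sigma U m0 p (obs H noise x0 w).

(** The observation at [x] is the one at [x0] with noise translated by [H *m x - m0]; this is the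
    density of that translation. *)
Definition likelihood (x : 'cV[R]_N) (w : Omega) : R :=
  cmdens sigma (H *m x - m0) (noise w).

Definition zcoord (x : 'cV[R]_N) : 'cV[R]_D := sigma^-1 *: (U^T *m H *m x).

Definition bscale (x : 'cV[R]_N) : R :=
  expR ((2 * sigma ^+ 2)^-1 * sqnorm m0 - (sigma ^+ 2)^-1 * dot (H *m x) m0).

(** Besides being the coefficients of the likelihood, these are the weights of [a p] in the
    constraint defining the set C(c). *)
Definition bcoef (x : 'cV[R]_N) (p : mindex D) : R :=
  bscale x * (mpow (zcoord x) p / Num.sqrt (mfact R p)).

Lemma mfact_gt0 (p : mindex D) : 0 < mfact R p.
Proof. by apply: prodr_gt0 => l _; rewrite ltr0n fact_gt0. Qed.

Let sqrt_mfactM (p : mindex D) : Num.sqrt (mfact R p) * Num.sqrt (mfact R p) = mfact R p.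
Proof. by rewrite -expr2 sqr_sqrtr// ltW// mfact_gt0. Qed.

Lemma obs_tshift x w : obs H noise x w = tcol (tshift (H *m x) (noise w)).
Proof. by rewrite tcol_tshift. Qed.

Lemma measurable_estimator gh x : is_estimator gh ->
  measurable_fun setT (fun w => gh (obs H noise x w)).
Proof.
move=> mgh; under eq_fun do rewrite obs_tshift.
exact: (measurableT_comp mgh (measurableT_comp (measurable_tshift (H *m x)) mnoise)).
Qed.

Lemma measurable_obasis p : measurable_fun setT (obasis p).
Proof.
have := @measurable_estimator (hbasis sigma U m0 p) x0; apply.
exact: measurable_hbasis.
Qed.

(* Translating the noise by -2 m0 absorbs the exponential factors of the basis. *)
Let tilt_expectation (G : 'cV[R]_M -> R) v :
  measurable_fun setT (fun t : M.-tuple R => G (2 *: m0 + tcol t)) ->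
  has_expectation P (fun w => G (n w)) v ->
  has_expectation P (fun w => cmdens sigma (- (2 *: m0)) (noise w) * G (2 *: m0 + n w)) v.
Proof.
move=> mG Gv.
apply: (cameron_martin_expectation sigma0 Hnoise _ _ mG).1.
by apply: eq_has_expectation Gv => // w; rewrite tcol_tshift addrA subrr add0r.
Qed.

Let measurable_prod_hermite (q : 'I_D -> {poly R}) v :
  measurable_fun setT (fun t : M.-tuple R => \prod_l (q l).[gp l (v + tcol t)]).
Proof.
apply: measurable_prod => l _.
have mh : measurable_fun setT (fun x : R => (q l).[x]).
  apply: continuous_measurable_fun => x; exact: continuous_horner.
have := measurableT_comp mh (measurable_gproj sigma U l v).
by congr measurable_fun; apply/funext => t /=; rewrite addrC.
Qed.

Lemma obasis_orthonormal_expectation p q :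
  has_expectation P (fun w => obasis p w * obasis q w) (p == q)%:R.
Proof.
pose c := (Num.sqrt (mfact R p))^-1 * (Num.sqrt (mfact R q))^-1.
pose G (y : 'cV[R]_M) := c * \prod_l (hermite (p l) * hermite (q l)).[gp l y].
have mG : measurable_fun setT (fun t : M.-tuple R => G (2 *: m0 + tcol t)).
  by apply: measurable_funM.
have EG := has_expectationZ c (gauss_projection_expectation sigma0 Hnoise UU
  (fun l => hermite (p l) * hermite (q l)) (fun=> 0)).
have EG' : has_expectation P (fun w => G (n w)) (p == q)%:R.
  apply: eq_has_expectation EG => [w|].
    by rewrite /G; congr (_ * _); apply: eq_bigr => l _; rewrite mul0r expR0 mulr1.
  under eq_bigr do rewrite gauss_functional_hermiteM.
  have [pq|pq] := eqVneq p q.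
    rewrite (_ : \prod_l _ = mfact R q); last first.
      by apply: eq_bigr => i _; rewrite pq eqxx.
    by rewrite /c pq -invfM sqrt_mfactM mulVf// gt_eqF// mfact_gt0.
  have [l /negbTE pql] : exists l, p l != q l.
    apply/existsP; rewrite -[X in is_true X]negbK negb_exists; apply/negP => /forallP e.
    by case/eqP: pq; apply/ffunP => l; have := e l; rewrite negbK => /eqP.
  by rewrite (bigD1 l)//= pql mul0r mulr0.
apply: eq_has_expectation (tilt_expectation mG EG') => // w.
rewrite /obasis /hbasis /G cmdens_dot /obs -/m0 -/(n w).
have -> : m0 + n w + m0 = 2 *: m0 + n w by rewrite scaler_nat mulr2n addrAC.
under eq_bigr do rewrite hornerM.
rewrite big_split/=.
set A := \prod_l (hermite (p l)).[_]; set B := \prod_l (hermite (q l)).[_].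
transitivity (expR (- dot (m0 + n w) m0 / sigma ^+ 2 - dot (m0 + n w) m0 / sigma ^+ 2)
  * (c * (A * B))).
  congr (_ * _); congr expR; rewrite !dot_simp (dotC (n w) m0); field.
  by rewrite sN0.
by rewrite expRD /c mulNr; ring.
Qed.

Lemma sqintegrable_obasis p : sqintegrable P (obasis p).
Proof.
split; first exact: measurable_obasis.
have [+ _] := obasis_orthonormal_expectation p p.
by congr (integrable _ _); apply/funext => w /=; rewrite expr2.
Qed.

Lemma obasis_orthonormal p q : inner P (obasis p) (obasis q) = (p == q)%:R.
Proof. exact/has_inner/obasis_orthonormal_expectation. Qed.

Lemma measurable_likelihood x : measurable_fun setT (likelihood x).
Proof. exact: (measurableT_comp (measurable_cmdens sigma _) mnoise). Qed.

(** The squared density for h is exp (|h|^2 / sigma^2) times the density for 2 h, which has mean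
    1. *)
Lemma likelihood_sq_expectation x :
  has_expectation P (fun w => likelihood x w * likelihood x w)
    (expR (dot (H *m x - m0) (H *m x - m0) / sigma ^+ 2)).
Proof.
set h := H *m x - m0.
have E1 : has_expectation P (fun w => cmdens sigma (2 *: h) (noise w)) 1.
  apply: ge0_has_expectation => [|w|]; last exact: integral_cmdens.
    exact: (measurableT_comp (measurable_cmdens sigma _) mnoise).
  exact: expR_ge0.
apply: eq_has_expectation (has_expectationZ (expR (dot h h / sigma ^+ 2)) E1) => [w|].
  rewrite /likelihood -/h !cmdens_dot -!expRD !dot_simp; congr expR; field.
  by rewrite sN0.
by rewrite mulr1.
Qed.

Lemma sqintegrable_likelihood x : sqintegrable P (likelihood x).
Proof.
split; first exact: measurable_likelihood.
have [+ _] := likelihood_sq_expectation x.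
by congr (integrable _ _); apply/funext => w /=; rewrite expr2.
Qed.

Lemma inner_likelihood x : inner P (likelihood x) (likelihood x) =
  expR (dot (H *m x - m0) (H *m x - m0) / sigma ^+ 2).
Proof. exact/has_inner/likelihood_sq_expectation. Qed.

(** By [UH], [H *m x] lies in the range of [U], so only the projections of [y] enter. *)
Let dot_HxU x y : dot (H *m x) y / sigma ^+ 2 = \sum_l zcoord x l 0 * gp l y.
Proof.
rewrite -{1}UH -!mulmxA dot_mulmx /dot mulr_suml; apply: eq_bigr => l _.
by rewrite [zcoord _ _ _]mxE /gproj -!mulmxA; field.
Qed.

Lemma zcoord_norm x : \sum_l zcoord x l 0 ^+ 2 = dot (H *m x) (H *m x) / sigma ^+ 2.
Proof.
rewrite dot_HxU; apply: eq_bigr => l _.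
rewrite expr2; congr (_ * _).
by rewrite mxE /gproj -mulmxA mulrC.
Qed.

Lemma likelihood_obasis_expectation x p :
  has_expectation P (fun w => likelihood x w * obasis p w) (bcoef x p).
Proof.
(* The constant left in the exponent of the likelihood times the basis function, once the density
   for -2 m0 and the term linear in 2 m0 + n are split off. *)
pose kap := (dot m0 m0 / 2 - dot (H *m x) m0 - dot (H *m x) (H *m x) / 2) / sigma ^+ 2.
pose c := expR kap / Num.sqrt (mfact R p).
pose G (y : 'cV[R]_M) := c * (\prod_l (hermite (p l)).[gp l y] *
  expR (dot (H *m x) y / sigma ^+ 2)).
have mG : measurable_fun setT (fun t : M.-tuple R => G (2 *: m0 + tcol t)).
  apply: measurable_funM => //; apply: measurable_funM.
    exact: (measurable_prod_hermite (fun l => hermite (p l))).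
  apply: measurableT_comp => //; apply: measurable_funM => //.
  under eq_fun do rewrite dotDr.
  by apply: measurable_funD => //; exact: measurable_dot_tcol.
have EG := has_expectationZ c (gauss_projection_expectation sigma0 Hnoise UU
  (fun l => hermite (p l)) (fun l => zcoord x l 0)).
have EG' : has_expectation P (fun w => G (n w)) (bcoef x p).
  apply: eq_has_expectation EG => [w|].
    by rewrite /G dot_HxU expR_sum -big_split.
  under eq_bigr do rewrite gauss_functional_hermite.
  rewrite big_split/= -expR_sum -mulr_suml zcoord_norm -/(mpow (zcoord x) p).
  transitivity (expR kap * expR (dot (H *m x) (H *m x) / sigma ^+ 2 / 2) *
    (mpow (zcoord x) p / Num.sqrt (mfact R p))); first by rewrite /c; ring.
  rewrite /bcoef; congr (_ * _); rewrite -expRD /bscale sqnormE; congr expR; rewrite /kap; field.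
  by rewrite sN0.
apply: eq_has_expectation (tilt_expectation mG EG') => // w.
rewrite /obasis /hbasis /G /likelihood !cmdens_dot /obs -/m0 -/(n w).
have -> : m0 + n w + m0 = 2 *: m0 + n w by rewrite scaler_nat mulr2n addrAC.
set A := \prod_l (hermite (p l)).[_].
rewrite /c.
transitivity (expR (dot (- (2 *: m0)) (n w) / sigma ^+ 2 -
   dot (- (2 *: m0)) (- (2 *: m0)) / (2 * sigma ^+ 2) + kap +
   dot (H *m x) (2 *: m0 + n w) / sigma ^+ 2) * (A / Num.sqrt (mfact R p))).
  by rewrite !expRD; ring.
transitivity (expR (dot (H *m x - m0) (n w) / sigma ^+ 2 -
   dot (H *m x - m0) (H *m x - m0) / (2 * sigma ^+ 2) +
   (- dot (m0 + n w) m0 / sigma ^+ 2)) * (A / Num.sqrt (mfact R p))).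
  congr (_ * _); congr expR; rewrite /kap !dot_simp (dotC (n w) m0) (dotC m0 (H *m x)); field.
  by rewrite sN0.
by rewrite !expRD; ring.
Qed.

Lemma inner_likelihood_obasis x p : inner P (likelihood x) (obasis p) = bcoef x p.
Proof. exact/has_inner/likelihood_obasis_expectation. Qed.

(** On a box, the sum of z^(2p) / p! is a product of partial exponential series in the z_l^2. This
    gives the equality case of Bessel's inequality demanded by [parseval]. *)
Lemma cvg_bsum_bcoef x : bsum (fun p => bcoef x p ^+ 2) K @[K --> \oo] -->
  inner P (likelihood x) (likelihood x).
Proof.
have -> : inner P (likelihood x) (likelihood x) =
    bscale x ^+ 2 * \prod_l expR (zcoord x l 0 ^+ 2).
  rewrite inner_likelihood -expR_sum zcoord_norm [bscale x ^+ 2]expr2 /bscale -!expRD.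
  rewrite sqnormE; congr expR.
  rewrite !dot_simp (dotC m0 (H *m x)); field.
  by rewrite sN0.
(* Exponents from 0 to [K] make [K.+1] terms in each series. *)
have -> : bsum (fun p => bcoef x p ^+ 2) = (fun K => bscale x ^+ 2 *
    \prod_l series (exp_coeff (zcoord x l 0 ^+ 2)) K.+1).
  apply/funext => K; under eq_bsum do rewrite exprMn.
  rewrite bsumZ; congr (_ * _).
  under [in RHS]eq_bigr do rewrite seriesEord/=.
  rewrite bigA_distr_bigA/=; apply: eq_bigr => q _.
  rewrite exprMn exprVn sqr_sqrtr ?(ltW (mfact_gt0 _))// /mpow /mfact -prodfV -prodrXl -big_split/=.
  by apply: eq_bigr => l _; rewrite ffunE /exp_coeff/= -!exprM mulnC.
apply: cvgMl_tmp; apply: cvg_prod_ord => l.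
rewrite (cvg_shiftS (series (exp_coeff (zcoord x l 0 ^+ 2)))).
exact: is_cvg_series_exp_coeff.
Qed.

Lemma in_l2_bcoef x : in_l2 (bcoef x).
Proof.
have := bessel_l2 sqintegrable_obasis obasis_orthonormal (sqintegrable_likelihood x).
by congr in_l2; apply/funext => p; rewrite inner_likelihood_obasis.
Qed.

(** A change of measure writes the mean at [x] as an inner product at [x0] with the likelihood,
    which [parseval] expands. The coefficients at [x0] thus determine the means at every [x]. *)
Lemma estimator_mean gh x : is_estimator gh ->
  sqintegrable P (fun w => gh (obs H noise x0 w)) ->
  has_expectation P (fun w => gh (obs H noise x w))
    (usum (fun p => inner P (fun w => gh (obs H noise x0 w)) (obasis p) * bcoef x p)).
Proof.
move=> mgh sX.
have -> : usum (fun p => inner P (fun w => gh (obs H noise x0 w)) (obasis p) * bcoef x p) =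
    inner P (fun w => gh (obs H noise x0 w)) (likelihood x).
  rewrite -(parseval sqintegrable_obasis obasis_orthonormal sX (sqintegrable_likelihood x)).
    by congr usum; apply/funext => p; rewrite inner_likelihood_obasis.
  rewrite (_ : (fun p => inner P (likelihood x) (obasis p) ^+ 2) = (fun p => bcoef x p ^+ 2)).
    exact: cvg_bsum_bcoef.
  by apply/funext => p; rewrite inner_likelihood_obasis.
(* The shift to [x0] is built in, so that a further translation by [H *m x - m0] lands on the
   observation at [x]. *)
pose G (t : M.-tuple R) := gh (tcol (tshift m0 t)).
have mG : measurable_fun setT G by exact: (measurableT_comp mgh (measurable_tshift m0)).
have E := inner_expectation sX (sqintegrable_likelihood x).
have E' : has_expectation P (fun w => cmdens sigma (H *m x - m0) (noise w) * G (noise w))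
    (inner P (fun w => gh (obs H noise x0 w)) (likelihood x)).
  by apply: eq_has_expectation E => // w; rewrite /G -obs_tshift mulrC.
have := (cameron_martin_expectation sigma0 Hnoise _ _ mG).2 E'.
apply: eq_has_expectation => // w; rewrite /G; congr gh.
by rewrite !tcol_tshift /obs addrA addrCA subrr addr0.
Qed.

End likelihood.

(** * Explicit form of the derivatives chi *)

Section hermite_generating_function.
Context {R : realType}.

(** exp (a x - x^2 / 2) generates the Hermite polynomials: its k-th derivative at 0 is He_k(a). A
    general [x] allows iteration. *)
Lemma is_derive_hermite_gf (a : R) k (x : R) :
  is_derive x 1 (fun x => (hermite k).[a - x] * expR (a * x - x ^+ 2 / 2))
    ((hermite k.+1).[a - x] * expR (a * x - x ^+ 2 / 2)).
Proof.
have h1 : is_derive x 1 (fun x : R => a - x) (-1).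
  by apply: is_derive_eq; rewrite /GRing.scale/=; ring.
have h2 : is_derive x 1 (fun x : R => a * x - x ^+ 2 / 2) (a - x).
  by apply: is_derive_eq; rewrite /GRing.scale/=; field.
have h3 := @is_derive1_comp R expR _ x _ _ (is_derive_expR _) h2.
have h4 := @is_derive1_comp R (fun y => (hermite k).[y]) _ x _ _ (is_derive_poly _ _) h1.
have h5 := is_deriveM h4 h3.
apply: (is_derive_eq h5); rewrite /GRing.scale/= hornerD hornerN hornerM hornerX; ring.
Qed.

End hermite_generating_function.

Section chi_explicit.
Context {R : realType} (M N D : nat) (H : 'M[R]_(M, N)) (sigma : R) (x0 : 'cV[R]_N)
  (U : 'M[R]_(M, D)) (Ht : 'M[R]_(N, D)).
Hypotheses (sigma0 : 0 < sigma) (UU : U^T *m U = 1%:M) (HHt : H *m Ht = U).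

(** Since H Ht = U has orthonormal columns, the function of z is a constant times the product of the
    exp (g_l z_l - z_l^2 / 2) with g = U^T (y + m0) / sigma. *)
Lemma chi_hbasis (p : mindex D) (y : 'cV[R]_M) (a : R) :
  expR (- (2 * sigma ^+ 2)^-1 * sqnorm (H *m x0)) * (a / Num.sqrt (mfact R p) *
    mderiv p (fun z : 'cV[R]_D =>
      expR (- (2 * sigma ^+ 2)^-1 * (2 * (y^T *m H *m (x0 - sigma *: (Ht *m z))) 0 0 +
        sqnorm (H *m (sigma *: (Ht *m z))) - sqnorm (H *m x0))) *
      expR (sigma^-1 * (x0^T *m H^T *m H *m Ht *m z) 0 0)) 0) =
  a * hbasis sigma U (H *m x0) p y.
Proof.
have sN0 : sigma != 0 by rewrite gt_eqF.
pose m0 := H *m x0.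
pose phi (l : 'I_D) k (x : R) := (hermite k).[gproj sigma U l (y + m0) - x] *
  expR (gproj sigma U l (y + m0) * x - x ^+ 2 / 2).
pose c := expR (- (2 * sigma ^+ 2)^-1 * (2 * dot y m0 - dot m0 m0)).
have -> : (fun z : 'cV[R]_D =>
      expR (- (2 * sigma ^+ 2)^-1 * (2 * (y^T *m H *m (x0 - sigma *: (Ht *m z))) 0 0 +
        sqnorm (H *m (sigma *: (Ht *m z))) - sqnorm (H *m x0))) *
      expR (sigma^-1 * (x0^T *m H^T *m H *m Ht *m z) 0 0)) =
    (fun z : 'cV[R]_D => c * \prod_i phi i 0%N (z i 0)).
  apply/funext => z.
  have e1 : (y^T *m H *m (x0 - sigma *: (Ht *m z))) 0 0 =
      dot y m0 - sigma * dot y (U *m z).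
    rewrite -mulmxA mulmxBr -scalemxAr (mulmxA H Ht) HHt -/m0 -dotE.
    by rewrite dotDr dotNr dotZr.
  have e2 : sqnorm (H *m (sigma *: (Ht *m z))) = sigma ^+ 2 * dot z z.
    rewrite -scalemxAr (mulmxA H Ht) HHt sqnormE dotZl dotZr dot_mulmx mulmxA UU mul1mx.
    by ring.
  have e3 : (x0^T *m H^T *m H *m Ht *m z) 0 0 = dot m0 (U *m z).
    by rewrite -trmx_mul -(mulmxA _ H Ht) HHt -mulmxA -dotE.
  have e4 : \sum_l (gproj sigma U l (y + m0) * z l 0 - z l 0 ^+ 2 / 2) =
      (dot y (U *m z) + dot m0 (U *m z)) / sigma - dot z z / 2.
    rewrite big_split/= sumrN -mulr_suml -sqnormE -/(sqnorm z); congr (_ - _).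
    rewrite -dotDl dotC dot_mulmx /dot mulr_suml; apply: eq_bigr => l _.
    by rewrite /gproj; ring.
  have e5 : \prod_i phi i 0%N (z i 0) =
      expR (\sum_l (gproj sigma U l (y + m0) * z l 0 - z l 0 ^+ 2 / 2)).
    by rewrite expR_sum; apply: eq_bigr => i _; rewrite /phi hornerC mul1r.
  rewrite e1 e2 e3 e5 e4 sqnormE -/m0 /c -!expRD; congr expR; field.
  by rewrite sN0.
rewrite (mderiv_prod (fun i k x => is_derive_hermite_gf (gproj sigma U i (y + m0)) k x)).
rewrite /hbasis -/m0.
have -> : \prod_i phi i (p i) ((0 : 'cV[R]_D) i 0) =
    \prod_l (hermite (p l)).[gproj sigma U l (y + m0)].
  apply: eq_bigr => l _; rewrite /phi mxE subr0 mulr0 expr0n/= mul0r subr0 expR0.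
  by rewrite mulr1.
transitivity (expR (- (2 * sigma ^+ 2)^-1 * sqnorm m0 +
  - (2 * sigma ^+ 2)^-1 * (2 * dot y m0 - dot m0 m0)) *
  (a / Num.sqrt (mfact R p) * \prod_l (hermite (p l)).[gproj sigma U l (y + m0)])).
  by rewrite expRD /c; ring.
have -> : - (2 * sigma ^+ 2)^-1 * sqnorm m0 +
    - (2 * sigma ^+ 2)^-1 * (2 * dot y m0 - dot m0 m0) = - dot y m0 / sigma ^+ 2.
  by rewrite sqnormE; field.
by ring.
Qed.

End chi_explicit.

(** * Variance and second moment of an estimator *)

Section estimator_variance.
Context {R : realType} {d : measure_display} {Omega : measurableType d}.
Variables (P : probability Omega R) (M N : nat) (H : 'M[R]_(M, N)).
Variable noise : Omega -> M.-tuple R.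

Lemma est_variance_sqintegrable gh x v :
  let X w := gh (obs H noise x w) in
  sqintegrable P X -> has_expectation P X v ->
  est_variance P H noise gh x = (inner P X X - v ^+ 2)%:E.
Proof.
move=> X sX Xv.
have mv : mean P H noise gh x = v by case: Xv => _; rewrite /mean => ->.
rewrite /est_variance mv.
have s1 := sqintegrable1 P.
have E1 : has_expectation P (fun=> 1) 1.
  apply: eq_has_expectation (inner_expectation s1 s1) => [w|]; first by rewrite mulr1.
  apply: has_inner; split.
    by have := s1.2; congr (integrable _ _); apply/funext => w /=; rewrite expr2.
  have := expectation_cst P 1; rewrite unlock => e1.
  by rewrite -e1; apply: eq_integral => w _; rewrite mulr1.
have E := has_expectationD (has_expectationB (inner_expectation sX sX)
  (has_expectationZ (2 * v) Xv)) (has_expectationZ (v ^+ 2) E1).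
have -> : inner P X X - v ^+ 2 = inner P X X - 2 * v * v + v ^+ 2 * 1 by ring.
by have [_ <-] := E; apply: eq_integral => w _; congr EFin; rewrite /X; ring.
Qed.

(** Whatever real number [mean] returns, the estimator minus that constant is square integrable, and
    the constant can be added back. *)
Lemma finite_variance_sqintegrable gh x :
  measurable_fun setT (fun w => gh (obs H noise x w)) ->
  (est_variance P H noise gh x < +oo)%E ->
  sqintegrable P (fun w => gh (obs H noise x w)).
Proof.
move=> mX vX; set m := mean P H noise gh x.
have s1 : sqintegrable P (fun w => gh (obs H noise x w) - m).
  by apply: sqintegrableP => //; exact: measurable_funB.
have := sqintegrableD s1 (sqintegrableZ m (sqintegrable1 P)).
by congr sqintegrable; apply/funext => w; rewrite mulr1 subrK.
Qed.

End estimator_variance.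

(** * Minimum variance as a minimal norm problem *)

Theorem theorem6 (R : realType) (d : measure_display) (Omega : measurableType d)
  (P : probability Omega R) (M N S D : nat) (H : 'M[R]_(M, N)) (sigma : R)
  (noise : Omega -> M.-tuple R) (g c : 'cV[R]_N -> R) (x0 : 'cV[R]_N)
  (U : 'M[R]_(M, D)) (s : 'rV[R]_D) (V : 'M[R]_(N, D)) (Htp : 'M[R]_(D, N)) :
  (1 <= S)%N -> (S <= N)%N -> (S < spark H)%N ->
  0 < sigma -> gauss_noise P noise sigma ->
  sparse_set S x0 ->
  D = \rank H -> thin_svd H U s V ->
  let Ht : 'M[R]_(N, D) := V *m invmx (diag_mx s) in
  is_pinv Ht Htp ->
  valid_bias P H noise S g c x0 ->
  let gamma := c x0 + g x0 in
  let Cset : set (mindex D -> R) :=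
    [set a | in_l2 a /\
      forall x, sparse_set S x ->
        c x = expR ((2 * sigma ^+ 2)^-1 * sqnorm (H *m x0)
                    - (sigma ^+ 2)^-1 * (x^T *m H^T *m H *m x0) 0 0)
              * usum (fun p : mindex D =>
                   a p / Num.sqrt (mfact R p) * mpow (sigma^-1 *: (Htp *m x)) p)
              - g x] in
  let rho (y : 'cV[R]_M) (x : 'cV[R]_N) : R :=
    expR (- (2 * sigma ^+ 2)^-1 *
          (2 * (y^T *m H *m (x0 - x)) 0 0 + sqnorm (H *m x) - sqnorm (H *m x0))) in
  let chi (p : mindex D) (y : 'cV[R]_M) : R :=
    mderiv p (fun z : 'cV[R]_D =>
        rho y (sigma *: (Ht *m z)) *
        expR (sigma^-1 * (x0^T *m H^T *m H *m Ht *m z) 0 0)) 0 in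
  let term (a : mindex D -> R) (p : mindex D) (y : 'cV[R]_M) : R :=
    expR (- (2 * sigma ^+ 2)^-1 * sqnorm (H *m x0)) *
    (a p / Num.sqrt (mfact R p) * chi p y) in
  (* (1) *)
  (exists a0, Cset a0 /\ (forall a, Cset a -> l2sq a0 <= l2sq a) /\
     min_var P H noise S g c x0 = l2sq a0 - gamma ^+ 2) /\
  (* (2) *)
  (forall a, Cset a ->
     (exists gh, L2_series_limit P H noise (term a) x0 gh) /\
     (forall gh, L2_series_limit P H noise (term a) x0 gh ->
        admissible P H noise S g c x0 gh)) /\
  (* (3) *)
  (forall a0, Cset a0 -> (forall a, Cset a -> l2sq a0 <= l2sq a) ->
     forall gh, L2_series_limit P H noise (term a0) x0 gh ->
       is_LMV P H noise S g c x0 gh).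
Proof.
move=> _ _ _ sigma0 Hnoise spx0 _ svd Ht pinv valid gamma Cset rho chi term.
have UU : U^T *m U = 1%:M by case: svd.
have UH := svd_proj svd.
have HHt : H *m Ht = U := svd_mulmx_Ht svd.
have HtpE := svd_pinvE svd pinv.
pose e := obasis noise H sigma U x0.
pose b := bcoef H sigma U x0.
have se p : sqintegrable P (e p) by exact: sqintegrable_obasis.
have orth p q : inner P (e p) (e q) = (p == q)%:R by exact: obasis_orthonormal.
have bl2 x : in_l2 (b x) by exact: (in_l2_bcoef x0 sigma0 Hnoise UU UH).
have termE a gh : L2_series_limit P H noise (term a) x0 gh <-> is_estimator gh /\
    (\int[P]_w ((box_comb e a K w - gh (obs H noise x0 w)) ^+ 2)%:E)%E @[K --> \oo] --> 0%E.
  rewrite /L2_series_limit.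
  rewrite (_ : (fun K : nat => _) = (fun K : nat =>
    \int[P]_w ((box_comb e a K w - gh (obs H noise x0 w)) ^+ 2)%:E)%E)//.
  apply/funext => K; apply: eq_integral => w _; congr (((_ - _) ^+ 2)%:E).
  apply: eq_bigr => q _; exact: (chi_hbasis x0 sigma0 UU HHt).
(* With the exponential absorbed into [b x], each constraint becomes linear and continuous in
   [a]. *)
have CsetE a : Cset a <-> in_l2 a /\ forall x, sparse_set S x ->
    c x = usum (fun p => a p * b x p) - g x.
  suff usumE x : in_l2 a -> usum (fun p => a p * b x p) =
      expR ((2 * sigma ^+ 2)^-1 * sqnorm (H *m x0)
                    - (sigma ^+ 2)^-1 * (x^T *m H^T *m H *m x0) 0 0)
              * usum (fun p : mindex D =>
                   a p / Num.sqrt (mfact R p) * mpow (sigma^-1 *: (Htp *m x)) p).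
    by split=> -[al2 aE]; split=> // x spx; rewrite aE// usumE.
  move=> al2.
  pose A := bscale H sigma x0 x.
  pose beta p := mpow (zcoord H sigma U x) p / Num.sqrt (mfact R p).
  have A0 : A != 0 by rewrite gt_eqF// expR_gt0.
  have beta2 : in_l2 beta.
    have := in_l2_comb A^-1 0 (bl2 x) (bl2 x); congr in_l2; apply/funext => p.
    by rewrite mul0r addr0 /b /bcoef -/A -/(beta p) mulrA mulVf// mul1r.
  have -> : expR ((2 * sigma ^+ 2)^-1 * sqnorm (H *m x0)
      - (sigma ^+ 2)^-1 * (x^T *m H^T *m H *m x0) 0 0) = A.
    by rewrite /A /bscale dotE trmx_mul !mulmxA.
  transitivity (A * usum (fun p => a p * beta p)).
    have := usum_comb A 0 al2 al2 beta2; rewrite mul0r addr0 => <-.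
    by congr usum; apply/funext => p; rewrite /b /bcoef -/A -/(beta p); ring.
  congr (_ * usum _); apply/funext => p.
  by rewrite /beta /zcoord HtpE; ring.
have meanE gh x : is_estimator gh -> sqintegrable P (fun w => gh (obs H noise x0 w)) ->
    has_expectation P (fun w => gh (obs H noise x w))
      (usum (fun p => inner P (fun w => gh (obs H noise x0 w)) (e p) * b x p)).
  exact: (estimator_mean sigma0 Hnoise UU UH).
(* Every admissible estimator has mean [gamma] at [x0], so only its second moment varies, and
   Bessel's inequality bounds that from below. *)
have coefs gh : admissible P H noise S g c x0 gh -> exists2 a, Cset a &
    ((l2sq a - gamma ^+ 2)%:E <= est_variance P H noise gh x0)%E.
  move=> [mgh _ vgh cgh].
  have sX := finite_variance_sqintegrable (measurable_estimator H Hnoise x0 mgh) vgh.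
  exists (fun p => inner P (fun w => gh (obs H noise x0 w)) (e p)).
    apply/CsetE; split; first exact: bessel_l2.
    move=> x spx; have [_ <-] := cgh x spx; rewrite /bias /mean.
    by have [_ ->] := meanE gh x mgh sX.
  have E0 := meanE gh x0 mgh sX.
  have gE : gamma = usum (fun p => inner P (fun w => gh (obs H noise x0 w)) (e p) * b x0 p).
    rewrite /gamma; have [_ <-] := cgh x0 spx0; rewrite /bias /mean subrK.
    by have [_ ->] := E0.
  rewrite (est_variance_sqintegrable sX E0) -gE lee_fin lerD2r.
  by apply: l2sq_le => K; exact: (bessel se orth).
(* For a series limit the second moment is exactly [l2sq a], so the bound of [coefs] is attained. *)
have limits a gh : Cset a -> L2_series_limit P H noise (term a) x0 gh ->
    admissible P H noise S g c x0 gh /\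
    est_variance P H noise gh x0 = (l2sq a - gamma ^+ 2)%:E.
  move=> /CsetE[al2 aE] /termE[mgh cgh].
  have [sX Xe XX] := L2_limit se orth (measurable_estimator H Hnoise x0 mgh) cgh.
  have E x : has_expectation P (fun w => gh (obs H noise x w)) (usum (fun p => a p * b x p)).
    have := meanE gh x mgh sX; congr (has_expectation _ _ (usum _)).
    by apply/funext => p; rewrite Xe.
  have vE : est_variance P H noise gh x0 = (l2sq a - gamma ^+ 2)%:E.
    by rewrite (est_variance_sqintegrable sX (E x0)) XX /gamma aE// subrK.
  split=> //; split=> //; first by have [] := E x0.
    by rewrite vE ltry.
  move=> x spx; split; first by have [] := E x.
  by rewrite /bias /mean aE//; have [_ ->] := E x.
have exists_limit a : Cset a -> exists gh, L2_series_limit P H noise (term a) x0 gh.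
  move=> /CsetE[al2 _].
  pose phi w := tshift (H *m x0) (noise w).
  have mphi : measurable_fun setT phi.
    exact: (measurableT_comp (measurable_tshift _) Hnoise.1).
  have eE p w : e p w = hbasis sigma U (H *m x0) p (tcol (phi w)).
    by rewrite /e /obasis obs_tshift.
  have eE' p : e p = fun w => hbasis sigma U (H *m x0) p (tcol (phi w)).
    by apply/funext => w; exact: eE.
  have [|||G [mG cG]] := @riesz_fischer R _ _ _ _ P phi D
    (fun p t => hbasis sigma U (H *m x0) p (tcol t)) mphi _ _ _ a al2.
  - by move=> p; exact: measurable_hbasis.
  - by move=> p; rewrite -eE'; exact: se.
  - by move=> p q; rewrite -!eE'; exact: orth.
  (* [G] acts on tuples and an estimator on columns; this undoes [tcol]. *)
  exists (fun y => G [tuple y i 0 | i < M]).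
  have GE t : G [tuple (tcol t) i 0 | i < M] = G t.
    by congr G; apply: eq_from_tnth => i; rewrite tnth_mktuple mxE.
  apply/termE; split.
    by have := mG; congr measurable_fun; apply/funext => t /=; rewrite GE.
  rewrite (_ : (fun K => _) = (fun K => (\int[P]_w ((box_comb
    (fun p w => hbasis sigma U (H *m x0) p (tcol (phi w))) a K w - G (phi w)) ^+ 2)%:E)%E))//.
  apply/funext => K; apply: eq_integral => w _.
  rewrite obs_tshift GE; congr (((_ - _) ^+ 2)%:E).
  by apply: eq_bigr => q _; rewrite eE.
have min_varE a0 : Cset a0 -> (forall a, Cset a -> l2sq a0 <= l2sq a) ->
    min_var P H noise S g c x0 = l2sq a0 - gamma ^+ 2.
  move=> Ca0 a0min; have [gh /(limits a0 gh Ca0)[agh vgh]] := exists_limit a0 Ca0.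
  set E := [set fine (est_variance P H noise gh x0) | gh in admissible P H noise S g c x0].
  have lbE : lbound E (l2sq a0 - gamma ^+ 2).
    move=> _ [gh' agh' <-]; have [a Ca va] := coefs gh' agh'.
    have [_ _ fv _] := agh'.
    rewrite -lee_fin fineK; last first.
      by rewrite ge0_fin_numE//; apply: integral_ge0 => w _; rewrite lee_fin sqr_ge0.
    by apply: le_trans va; rewrite lee_fin lerD2r a0min.
  have inE : E (l2sq a0 - gamma ^+ 2) by exists gh => //; rewrite vgh.
  apply/eqP; rewrite eq_le; apply/andP; split.
    by apply: ge_inf => //; exists (l2sq a0 - gamma ^+ 2).
  by apply: lb_le_inf => //; exists (l2sq a0 - gamma ^+ 2).
split.
  have [a0 [Ca0 a0min]] : exists a0, Cset a0 /\ forall a, Cset a -> l2sq a0 <= l2sq a.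
    apply: l2_min_norm.
    - by have [gh /coefs[a Ca _]] := valid; exists a.
    - by move=> a [].
    - move=> a a' /CsetE[al2 aE] /CsetE[al2' aE']; apply/CsetE; split.
        exact: in_l2_comb.
      move=> x spx; rewrite usum_comb//; have := aE x spx; have := aE' x spx; lra.
    - move=> a al2 aC; apply/CsetE; split=> // x spx.
      (* Closedness of one constraint: its defect at [a] is the pairing of [b x] with a difference
         of arbitrarily small norm, and Cauchy-Schwarz bounds its square by any [r]. *)
      suff : (c x + g x - usum (fun p => a p * b x p)) ^+ 2 <= 0.
        rewrite le_eqVlt ltNge sqr_ge0 orbF sqrf_eq0 => /eqP; lra.
      apply/ler_addgt0Pr => r r0; rewrite add0r.
      (* The added 1 gives a positive denominator without a case distinction. *)
      have B0 : 0 < l2sq (b x) + 1 by rewrite ltr_wpDl// l2sq_ge0.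
      have [a' /CsetE[al2' aE'] a'r] := aC (r / (l2sq (b x) + 1)) (divr_gt0 r0 B0).
      have -> : c x + g x - usum (fun p => a p * b x p) =
          usum (fun p => (1 * a' p + (-1) * a p) * b x p).
        by rewrite usum_comb// (aE' x spx); ring.
      apply: le_trans (usum_CauchySchwarz (in_l2_comb 1 (-1) al2' al2) (bl2 x)) _.
      apply: (@le_trans _ _ (r / (l2sq (b x) + 1) * l2sq (b x))).
        by rewrite ler_wpM2r// l2sq_ge0.
      by rewrite mulrAC ler_pdivrMr// ler_pM2l// lerDl.
  by exists a0; split=> //; split=> //; exact: min_varE.
split.
  move=> a Ca; split; first exact: exists_limit.
  by move=> gh /(limits a gh Ca)[].
move=> a0 Ca0 a0min gh /(limits a0 gh Ca0)[agh vgh]; split=> //.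
by rewrite vgh (min_varE a0).
Qed.
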